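(* Let $\{f_i\}_{i\in\mathbb{N}}$ be a frame of a Hilbert subspace $K$ of the separable Hilbert space $H$, let $\{e_i\}_{i\in\mathbb{N}}$ be the standard orthonormal basis of $l_2$, let $F:l_2\to H$ be the bounded linear operator with $F(e_i)=f_i$ for all $i$, and let $F=W|F|$ be its polar decomposition. Denote by $P$ the orthogonal projection of $l_2$ onto the (norm-closed) range of $F^*F$. Then the operator $P-|F|$ is Hilbert-Schmidt if and only if the sum $\sum_{j=1}^\infty\|\mu_j-f_j\|^2$ is finite for at least one normalized tight frame $\{\mu_i\}_{i\in\mathbb{N}}$ of a Hilbert subspace $L$ of $H$ that is weakly similar to $\{f_i\}_{i\in\mathbb{N}}$. In this situation the estimate $$\sum_{j=1}^\infty\|\mu_j-f_j\|^2\;\ge\;\sum_{j=1}^\infty\|W(e_j)-f_j\|^2\;=\;\|P-|F|\|_{c_2}^2$$ is valid for every normalized tight frame $\{\mu_i\}_{i\in\mathbb{N}}$ of any Hilbert subspace of $H$ that is weakly similar to $\{f_i\}_{i\in\mathbb{N}}$ (the left sum can be infinite for some choices of $\{\mu_i\}_{i\in\mathbb{N}}$). Equality holds in the inequality if and only if $\mu_i=W(e_i)$ for every $i\in\mathbb{N}$. Consequently, the symmetric approximation of the frame $\{f_i\}_{i\in\mathbb{N}}$ in $K\subseteq H$ is a normalized tight frame spanning the same Hilbert subspace $L=K$ of $H$ and being similar to $\{f_i\}_{i\in\mathbb{N}}$.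
   Context: Hilbert spaces are complex; a Hilbert subspace is a closed linear subspace. A family $\{f_i\}_{i\in\mathbb{N}}\subset K$ is a frame of a Hilbert subspace $K\subseteq H$ if there are constants $C,D>0$ with $C\|x\|^2\le\sum_j|\langle x,f_j\rangle|^2\le D\|x\|^2$ for all $x\in K$; it is normalized tight if one can take $C=D=1$. Two frames $\{f_i\}_i$ of $K$ and $\{g_i\}_i$ of $L$ (with the same index set) are weakly similar if there is an invertible bounded linear operator $T:K\to L$ with $T(f_i)=g_i$ for all $i$; if moreover $K=L$ they are called similar. For a frame $\{f_i\}_{i\in\mathbb{N}}$ the operator $F(\sum_j\alpha_je_j)=\sum_j\alpha_jf_j$ is bounded on $l_2$ with closed range $K$. In the polar decomposition $F=W|F|$, $|F|=(F^*F)^{1/2}$ acts on $l_2$ and $W:l_2\to H$ is the partial isometry with initial space $\ker(F)^\perp$ and range $\operatorname{ran}(F)$. $\|\cdot\|_{c_2}$ is the Hilbert-Schmidt norm. A normalized tight frame $\{\nu_i\}_{i\in\mathbb{N}}$ in a Hilbert subspace $L\subseteq H$ is a symmetric approximation of $\{f_i\}_{i\in\mathbb{N}}$ if it is weakly similar to $\{f_i\}_{i\in\mathbb{N}}$, the inequality $\sum_{j=1}^\infty\|\mu_j-f_j\|^2\ge\sum_{j=1}^\infty\|\nu_j-f_j\|^2$ holds for all normalized tight frames $\{\mu_i\}_{i\in\mathbb{N}}$ in Hilbert subspaces of $H$ that are weakly similar to $\{f_i\}_{i\in\mathbb{N}}$, and the right-hand sum is finite. *)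

(* Defs.v *)
From HB Require Import structures.
From mathcomp Require Import all_boot all_order all_algebra sesquilinear.
From mathcomp Require Import complex ring lra.
From mathcomp Require Import boolp classical_sets functions cardinality reals ereal.
From mathcomp Require Import topology normedtype sequences.

Set Implicit Arguments.
Unset Strict Implicit.
Unset Printing Implicit Defensive.

Import Order.TTheory GRing.Theory Num.Theory.
Import numFieldNormedType.Exports.

Local Open Scope classical_set_scope.
Local Open Scope complex_scope.
Local Open Scope ring_scope.

Local Notation Re := complex.Re.
Local Notation Im := complex.Im.

(* Complex Hilbert spaces over a model R of the reals. MathComp's hermitian
   forms are linear in the first argument and conjugate-linear in the second.
   Norms of elements of V take values in R[i]. *)
HB.mixin Record isHilbert (R : realType) V & CompleteNormedModule R[i] V := {
  dotp : {dot V for @Num.conj R[i]};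
  dotp_norm : forall x : V, `|x| ^+ 2 = dotp x x }.

#[short(type="hilbertType")]
HB.structure Definition Hilbert (R : realType) :=
  {V of CompleteNormedModule R[i] V & isHilbert R V}.

(* The norm as an element of R, for scalars as well as for vectors. *)
Definition rnorm (R : realType) (V : normedZmodType R[i]) (x : V) : R := Re `|x|.

Section DotCauchySchwarz.
Variables (C : numClosedFieldType) (U : lmodType C).
Variable form : {dot U for @Num.conj C}.
Local Notation "''[' u , v ]" := (form u v) : ring_scope.
Local Notation "''[' u ]" := (form u u) : ring_scope.

Lemma dot_CauchySchwarz u v : `|'[u, v]| ^+ 2 <= '[u] * '[v].
Proof.
have [->|v0] := eqVneq v 0.
  by rewrite linear0r normr0 expr0n; apply: mulr_ge0; exact: dnorm_ge0.
have v_gt0 : 0 < '[v] by rewrite dnorm_gt0.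
pose a := '[u, v] / '[v].
have : 0 <= '[u - a *: v] by exact: dnorm_ge0.
rewrite dnormB dnormZ linearZr_LR/=.
have vv : '[v]^* = '[v] by apply/CrealP/ger0_real/dnorm_ge0.
have E : a^* * '[u, v] = `|'[u, v]| ^+ 2 / '[v].
  by rewrite /a rmorphM/= fmorphV/= vv mulrAC [_^* * _]mulrC -normCK.
have F : `|a| ^+ 2 * '[v] = `|'[u, v]| ^+ 2 / '[v].
  rewrite /a normrM normfV (ger0_norm (ltW v_gt0)).
  rewrite exprMn -mulrA [X in _ * X = _](_ : _ = '[v]^-1)//.
  by rewrite expr2 -mulrA mulVf ?mulr1 ?gt_eqF.
rewrite E F; set x := (_ / _).
have xr : x^* = x.
  by apply/CrealP/ger0_real; rewrite divr_ge0 ?exprn_ge0 ?dnorm_ge0.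
by rewrite xr opprD addrA addrK subr_ge0 ler_pdivrMr.
Qed.

Lemma sqrt_dnormD u v : sqrtC '[u + v] <= sqrtC '[u] + sqrtC '[v].
Proof.
rewrite -ler_sqr ?nnegrE ?addr_ge0 ?sqrtC_ge0 ?dnorm_ge0//.
rewrite sqrrD !sqrtCK dnormD addrAC lerD2r lerD2l.
have H : `|'[u, v]| <= sqrtC '[u] * sqrtC '[v].
  rewrite -ler_sqr ?nnegrE ?mulr_ge0 ?sqrtC_ge0 ?dnorm_ge0//.
  by rewrite exprMn !sqrtCK; exact: dot_CauchySchwarz.
have -> : '[u, v] + '[u, v]^* = 'Re '[u, v] *+ 2.
  by rewrite ReE -mulr_natr divfK ?pnatr_eq0.
by rewrite lerMn2r/= (le_trans _ H)// leif_Re_Creal.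
Qed.
End DotCauchySchwarz.

Section SquareSummable.
Variable R : realType.
Implicit Types (a b z : nat -> R[i]) (c : R[i]).

Definition sq_summable a : Prop := cvgn (series (fun n => rnorm (a n) ^+ 2)).

Lemma rnorm_sq c : rnorm c ^+ 2 = Re c ^+ 2 + Im c ^+ 2.
Proof. by rewrite /rnorm normc_def/= sqr_sqrtr// addr_ge0// sqr_ge0. Qed.

Lemma rnorm_ge0 c : 0 <= rnorm c.
Proof. by rewrite /rnorm normc_def/= sqrtr_ge0. Qed.

Lemma rnormM c (d : R[i]) : rnorm (c * d) = rnorm c * rnorm d.
Proof. by rewrite /rnorm normrM !normc_def/= !mul0r subr0. Qed.

Lemma rnormD c (d : R[i]) : rnorm (c + d) <= rnorm c + rnorm d.
Proof. by have := ler_normD c d; rewrite /rnorm !normc_def -rmorphD lecR. Qed.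

Lemma sq_summable_le a (s : nat -> R) :
  (forall n, rnorm (a n) ^+ 2 <= s n) -> cvgn (series s) -> sq_summable a.
Proof.
move=> h; apply: series_le_cvg => // n; first exact: sqr_ge0.
by apply: le_trans (h n); exact: sqr_ge0.
Qed.

Lemma sq_summable0 : sq_summable 0.
Proof.
rewrite /sq_summable (_ : series _ = fun=> 0); first exact: is_cvg_cst.
by apply/funext => n; rewrite /series/= big1// => i _; rewrite /rnorm normr0 expr0n.
Qed.

Lemma sq_summableP c a b :
  sq_summable a -> sq_summable b -> sq_summable (c *: a + b).
Proof.
move=> ha hb; apply: (@sq_summable_le _
  ((rnorm c ^+ 2 *+ 2) *: (fun n => rnorm (a n) ^+ 2) +
   2 *: (fun n => rnorm (b n) ^+ 2))).
  move=> n; rewrite /GRing.add/= /GRing.scale/=.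
  apply: (@le_trans _ _ ((rnorm c * rnorm (a n) + rnorm (b n)) ^+ 2)).
    rewrite ler_sqr ?nnegrE ?rnorm_ge0 ?addr_ge0 ?mulr_ge0 ?rnorm_ge0//.
    by rewrite -rnormM; exact: rnormD.
  have := sqr_ge0 (rnorm c * rnorm (a n) - rnorm (b n)).
  set x := rnorm c; set y := rnorm (a n); set w := rnorm (b n) => h.
  rewrite -[leRHS]/((x ^+ 2 *+ 2) * y ^+ 2 + 2 * w ^+ 2) -subr_ge0.
  by rewrite [X in 0 <= X](_ : _ = (x * y - w) ^+ 2)//; ring.
by apply: is_cvg_seriesD; exact: is_cvg_seriesZ.
Qed.

Definition sq_summable_pred : {pred nat -> R[i]} := fun a => `[< sq_summable a >].

Fact sq_summable_submod : submod_closed sq_summable_pred.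
Proof.
split; first by apply/asboolP; exact: sq_summable0.
move=> c a b /asboolP ha /asboolP hb; apply/asboolP; exact: sq_summableP.
Qed.
HB.instance Definition _ :=
  GRing.isSubmodClosed.Build R[i] (nat -> R[i]) sq_summable_pred sq_summable_submod.
End SquareSummable.

(* Square-summable sequences, with <a, b> = sum_n a_n * conj(b_n). *)
Record l2 (R : realType) :=
  L2 { l2seq :> nat -> R[i]; l2seqP : l2seq \in @sq_summable_pred R }.
HB.instance Definition _ (R : realType) := [isSub for @l2seq R].
HB.instance Definition _ (R : realType) := [Choice of l2 R by <:].
HB.instance Definition _ (R : realType) := [SubChoice_isSubLmodule of l2 R by <:].

Section ComplexSeries.
Variable R : realType.
Implicit Types (a b z : nat -> R[i]) (c : R[i]).

Lemma conj_conjc c : c^* = conjc c. Proof. by []. Qed.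

Definition csummable z : Prop :=
  cvgn (series (fun n => Re (z n))) /\ cvgn (series (fun n => Im (z n))).

Definition csum z : R[i] :=
  limn (series (fun n => Re (z n))) +i* limn (series (fun n => Im (z n))).

Lemma rnorm_ge_Re c : `|Re c| <= rnorm c.
Proof.
rewrite -[_ <= _]/(`|Re c| <= Re `|c|) -lecR.
by apply: le_trans (normc_ge_Re c) _; rewrite normc_def.
Qed.

Lemma rnorm_ge_Im c : `|Im c| <= rnorm c.
Proof.
rewrite -ler_sqr ?nnegrE ?rnorm_ge0// rnorm_sq real_normK ?num_real//.
by rewrite lerDr sqr_ge0.
Qed.

Lemma csummable_le z (s : nat -> R) :
  (forall n, rnorm (z n) <= s n) -> cvgn (series s) -> csummable z.
Proof.
move=> h hs; split; apply: normed_cvg; apply: series_le_cvg hs => //= n.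
- exact: le_trans (rnorm_ge0 _) (h n).
- exact: le_trans (rnorm_ge_Re _) (h n).
- exact: le_trans (rnorm_ge0 _) (h n).
- exact: le_trans (rnorm_ge_Im _) (h n).
Qed.

Lemma rnorm_conj c : rnorm c^* = rnorm c.
Proof. by rewrite /rnorm norm_conjC. Qed.

Lemma csummable_conj_mul a b :
  sq_summable a -> sq_summable b -> csummable (fun n => a n * (b n)^*).
Proof.
move=> ha hb; apply: (@csummable_le _
  ((fun n => rnorm (a n) ^+ 2) + (fun n => rnorm (b n) ^+ 2))); last first.
  exact: is_cvg_seriesD.
move=> n; rewrite rnormM rnorm_conj.
rewrite -[leRHS]/(rnorm (a n) ^+ 2 + rnorm (b n) ^+ 2).
have := rnorm_ge0 (a n); have := rnorm_ge0 (b n).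
set x := rnorm (a n); set y := rnorm (b n) => y0 x0.
have := sqr_ge0 (x - y); have := sqr_ge0 x; have := sqr_ge0 y; nra.
Qed.

Lemma csumP c z z' : csummable z -> csummable z' ->
  csum (fun n => c * z n + z' n) = c * csum z + csum z'.
Proof.
case: c => p q [hr hi] [hr' hi']; rewrite /csum.
have -> : (fun n => Re ((p +i* q) * z n + z' n)) =
    (p *: (fun n => Re (z n)) - q *: (fun n => Im (z n))) + (fun n => Re (z' n)).
  apply/funext => n; rewrite -[RHS]/(p * Re (z n) - q * Im (z n) + Re (z' n)).
  by case: (z n) => ? ?; case: (z' n).
have -> : (fun n => Im ((p +i* q) * z n + z' n)) =
    (p *: (fun n => Im (z n)) + q *: (fun n => Re (z n))) + (fun n => Im (z' n)).
  apply/funext => n; rewrite -[RHS]/(p * Im (z n) + q * Re (z n) + Im (z' n)).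
  by case: (z n) => ? ?; case: (z' n).
have [rp iq] := (is_cvg_seriesZ (k := p) hr, is_cvg_seriesZ (k := q) hi).
have [ip rq] := (is_cvg_seriesZ (k := p) hi, is_cvg_seriesZ (k := q) hr).
rewrite (lim_seriesD (is_cvg_seriesB rp iq) hr') (lim_seriesB rp iq).
rewrite (lim_seriesD (is_cvg_seriesD ip rq) hi') (lim_seriesD ip rq).
by rewrite !lim_seriesZ.
Qed.

Lemma csum_conj z : csummable z -> csum (fun n => (z n)^*) = (csum z)^*.
Proof.
move=> [hr hi]; rewrite /csum.
have -> : (fun n => Re ((z n)^* : R[i])) = (fun n => Re (z n)).
  by apply/funext => n; rewrite conj_conjc; case: (z n).
have -> : (fun n => Im ((z n)^* : R[i])) = - (fun n => Im (z n)).
  by apply/funext => n; rewrite conj_conjc; rewrite -[RHS]/(- Im (z n)); case: (z n).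
by rewrite lim_seriesN.
Qed.

Lemma csum_norm2 a :
  csum (fun n => a n * (a n)^*) = (limn (series (fun n => rnorm (a n) ^+ 2)))%:C.
Proof.
rewrite /csum; have -> : (fun n => Re (a n * (a n)^*)) = (fun n => rnorm (a n) ^+ 2).
  by apply/funext => n; rewrite rnorm_sq conj_conjc; case: (a n) => p q /=; ring.
have -> : (fun n => Im (a n * (a n)^*)) = (fun=> 0).
  by apply/funext => n; rewrite conj_conjc; case: (a n) => p q /=; ring.
congr (_ +i* _); rewrite (_ : series _ = fun=> 0) ?lim_cst//.
by apply/funext => n; rewrite /series/= big1.
Qed.
End ComplexSeries.

Section L2Hilbert.
Variable R : realType.
Local Notation l2 := (l2 R).
Implicit Types a b : l2.

Definition l2_dot a b : R[i] := csum (fun n => a n * (b n)^*).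

Lemma l2_sq a : sq_summable a. Proof. exact/asboolP/(l2seqP a). Qed.

Lemma l2_csummable a b : csummable (fun n => a n * (b n)^*).
Proof. by apply: csummable_conj_mul; exact: l2_sq. Qed.

Fact l2_dotPl b : GRing.linear_for *%R (l2_dot^~ b).
Proof.
move=> c a a'; rewrite /l2_dot -csumP; [|exact: l2_csummable..].
by congr csum; apply/funext => n; rewrite mulrDl mulrA.
Qed.

Fact l2_dotC a b : l2_dot a b = (l2_dot b a)^*.
Proof.
rewrite /l2_dot -csum_conj; last exact: l2_csummable.
by congr csum; apply/funext => n; rewrite rmorphM/= conjCK mulrC.
Qed.

Fact l2_dotPr a : GRing.linear_for (@Num.conj R[i] \; *%R) (l2_dot a).
Proof.
by move=> c b b'; rewrite !(l2_dotC a) l2_dotPl rmorphD rmorphM.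
Qed.

Lemma l2_dotE a : l2_dot a a = (limn (series (fun n => rnorm (a n) ^+ 2)))%:C.
Proof. exact: csum_norm2. Qed.

Lemma l2_sum_le a n : \sum_(0 <= k < n) rnorm (a k) ^+ 2 <= Re (l2_dot a a).
Proof.
rewrite l2_dotE /=; apply: (@nondecreasing_cvgn_le _ (series _)); last exact: l2_sq.
by apply: nondecreasing_series => k _ _; exact: sqr_ge0.
Qed.

Fact l2_dot_gt0 a : a != 0 -> 0 < l2_dot a a.
Proof.
move=> a0; have [k ak] : exists k, a k != 0.
  apply: contrapT => /forallNP h; move/eqP: a0; apply; apply: val_inj.
  by apply/funext => k /=; move/negP: (h k); rewrite negbK => /eqP.
have E : l2_dot a a = (Re (l2_dot a a))%:C by rewrite l2_dotE.
rewrite E ltcR; apply: lt_le_trans (l2_sum_le a k.+1).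
rewrite big_nat_recr//= ltr_wpDl ?sumr_ge0//; first by move=> i _; exact: sqr_ge0.
rewrite exprn_gt0// lt_neqAle rnorm_ge0 andbT eq_sym.
apply: contra ak => /eqP h; rewrite -normr_eq0 normc_def.
by move: h; rewrite /rnorm normc_def /= => ->.
Qed.

HB.instance Definition _ := @bilinear_isBilinear.Build R[i] l2 l2 R[i]
  *%R (@Num.conj R[i] \; *%R) l2_dot (l2_dotPl, l2_dotPr).
HB.instance Definition _ :=
  @isHermitianSesquilinear.Build R[i] l2 false (@Num.conj R[i]) l2_dot
    (fun a b => etrans (l2_dotC a b) (esym (mul1r _))).
HB.instance Definition _ := @isDotProduct.Build R[i] l2 l2_dot l2_dot_gt0.

Definition l2_norm a : R[i] := sqrtC (l2_dot a a).

Fact l2_normD a b : l2_norm (a + b) <= l2_norm a + l2_norm b.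
Proof. exact: sqrt_dnormD. Qed.

Fact l2_normZ c a : l2_norm (c *: a) = `|c| * l2_norm a.
Proof.
rewrite /l2_norm dnormZ sqrtCM ?nnegrE ?exprn_ge0// ?sqrtC_ge0 ?dnorm_ge0//.
by rewrite sqrCK.
Qed.

Fact l2_norm0_eq0 a : l2_norm a = 0 -> a = 0.
Proof. by move=> /eqP; rewrite sqrtC_eq0 dnorm_eq0 => /eqP. Qed.

HB.instance Definition _ := @Lmodule_isNormed.Build R[i] l2 l2_norm
  l2_normD l2_normZ l2_norm0_eq0.
End L2Hilbert.

Section L2Complete.
Variable R : realType.
Local Notation l2 := (l2 R).
Implicit Types a b : l2.

Lemma l2_normE a : `|a| ^+ 2 = l2_dot a a.
Proof. by rewrite -[`|a|]/(l2_norm a) sqrtCK. Qed.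

Lemma rnormE a : `|a| = (rnorm a)%:C.
Proof. by rewrite /rnorm RRe_real// ger0_real. Qed.

Lemma l2_rnorm_sq a : rnorm a ^+ 2 = limn (series (fun n => rnorm (a n) ^+ 2)).
Proof.
apply: (@complexI R); rewrite -l2_dotE -l2_normE rnormE.
by rewrite rmorphXn.
Qed.

Lemma l2_rnorm_ge0 a : 0 <= rnorm a.
Proof. by rewrite -ler0c -rnormE normr_ge0. Qed.

Lemma l2_sum_le_sq a n : \sum_(0 <= k < n) rnorm (a k) ^+ 2 <= rnorm a ^+ 2.
Proof. by rewrite l2_rnorm_sq; have := l2_sum_le a n; rewrite l2_dotE. Qed.

Lemma l2_coord_le a k : rnorm (a k) <= rnorm a.
Proof.
rewrite -ler_sqr ?nnegrE ?rnorm_ge0 ?l2_rnorm_ge0//.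
apply: le_trans (l2_sum_le_sq a k.+1); rewrite big_nat_recr//= lerDr sumr_ge0//.
by move=> i _; exact: sqr_ge0.
Qed.

Lemma l2_cauchy_cvg (F : set_system l2) : ProperFilter F -> cauchy F -> cvg F.
Proof.
move=> FF /cauchy_ballP Fc.
have small (e : R) : 0 < e ->
    exists2 A, F A & forall x y, A x -> A y -> rnorm (x - y) <= e.
  move=> e0; have /Fc [[A B]/= [FA FB] AB] : 0 < e%:C by rewrite ltcR.
  exists (A `&` B); first exact: filterI.
  move=> x y [Ax _] [_ By]; have := AB (x, y) (conj Ax By) => /=.
  by rewrite -ball_normE/= rnormE ltcR => /ltW.
have coord (g : R[i] -> R) k : (forall c, `|g c| <= rnorm c) ->
    (forall c d, g (c - d) = g c - g d) -> cvg ((fun a : l2 => g (a k)) @ F).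
  move=> gle gB; apply: cauchy_cvg; apply/cauchy_ballP => e e0.
  have e2 : 0 < e / 2 by rewrite divr_gt0.
  have [A FA hA] := small _ e2.
  exists ((fun a : l2 => g (a k)) @` A, (fun a : l2 => g (a k)) @` A) => /=.
    by split; rewrite /= ?nbhs_simpl/=; apply: (@filterS l2 F _ A) FA => x Ax; exists x.
  move=> [_ _]/= [[x Ax <-] [y Ay <-]]; rewrite -ball_normE/= -gB.
  apply: le_lt_trans (gle _) _; apply: le_lt_trans (l2_coord_le (x - y) k) _.
  by apply: le_lt_trans (hA _ _ Ax Ay) _; rewrite ltr_pdivrMr// mulr_natr mulr2n ltrDl.
have ReB (c d : R[i]) : Re (c - d) = Re c - Re d by case: c; case: d.
have ImB (c d : R[i]) : Im (c - d) = Im c - Im d by case: c; case: d.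
have cRe k := coord (@Re R) k (@rnorm_ge_Re R) ReB.
have cIm k := coord (@Im R) k (@rnorm_ge_Im R) ImB.
pose s k : R[i] := lim ((fun a : l2 => Re (a k)) @ F) +i*
                   lim ((fun a : l2 => Im (a k)) @ F).
have sum_cvg (x : l2) n : (fun y : l2 => \sum_(0 <= k < n) rnorm (x k - y k) ^+ 2) @ F
    --> \sum_(0 <= k < n) rnorm (x k - s k) ^+ 2.
  elim: n => [|n IH].
    rewrite big_nil (_ : (fun _ => _) = (fun=> 0)); first exact: cvg_cst.
    by apply/funext => y; rewrite big_nil.
  rewrite big_nat_recr//= (_ : (fun _ => _) =
    (fun y : l2 => \sum_(0 <= k < n) rnorm (x k - y k) ^+ 2 +
      ((Re (x n) - Re (y n)) * (Re (x n) - Re (y n)) +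
       (Im (x n) - Im (y n)) * (Im (x n) - Im (y n))))); last first.
    apply/funext => y; rewrite big_nat_recr//= rnorm_sq !expr2.
    by case: (x n) => ? ?; case: (y n).
  have -> : rnorm (x n - s n) ^+ 2 =
      (Re (x n) - Re (s n)) * (Re (x n) - Re (s n)) +
      (Im (x n) - Im (s n)) * (Im (x n) - Im (s n)).
    by rewrite rnorm_sq !expr2; case: (x n) => ? ?; case: (s n).
  have cR : (fun y : l2 => Re (x n) - Re (y n)) @ F --> Re (x n) - Re (s n).
    by apply: cvgB; [exact: cvg_cst|exact: cRe].
  have cI : (fun y : l2 => Im (x n) - Im (y n)) @ F --> Im (x n) - Im (s n).
    by apply: cvgB; [exact: cvg_cst|exact: cIm].
  exact: cvgD IH (cvgD (cvgM cR cR) (cvgM cI cI)).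
have bound (e : R) : 0 < e -> exists2 A, F A & forall x, A x ->
    forall n, \sum_(0 <= k < n) rnorm (x k - s k) ^+ 2 <= e ^+ 2.
  move=> e0; have [A FA hA] := small e e0; exists A => // x Ax n.
  apply: (cvgr_to_le (sum_cvg x n)); apply: filterS FA => y Ay.
  apply: le_trans (l2_sum_le_sq (x - y) n) _.
  by rewrite ler_sqr ?nnegrE ?l2_rnorm_ge0 ?hA// ltW.
have bounded (u : nat -> R[i]) (M : R) :
    (forall n, \sum_(0 <= k < n) rnorm (u k) ^+ 2 <= M) -> sq_summable u.
  move=> h; apply: nondecreasing_is_cvgn.
    by apply: nondecreasing_series => k _ _; exact: sqr_ge0.
  by exists M => _ [n _ <-]; exact: h.
have s_l2 : s \in @sq_summable_pred R.
  have [A FA hA] := bound 1 ltr01.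
  have [x Ax] := filter_ex FA.
  have xs : (fun k => x k - s k) \in @sq_summable_pred R.
    by apply/asboolP; exact: bounded (hA x Ax).
  have -> : s = (x : nat -> R[i]) - (fun k => x k - s k).
    by apply/funext => k; rewrite -[RHS]/(x k - (x k - s k)) opprB addrC subrK.
  by apply: rpredB => //; exact: l2seqP.
apply: (cvgP (L2 s_l2)); apply/(@cvgrPdist_le _ l2 l2 F _ id) => e.
move=> e0; have er : 0 < Re e by move: e0; rewrite ltcE => /andP[].
have -> : e = (Re e)%:C by rewrite RRe_real// gtr0_real.
have [A FA hA] := bound (Re e) er; apply: filterS FA => x Ax.
rewrite distrC rnormE lecR -ler_sqr ?nnegrE ?l2_rnorm_ge0 ?(ltW er)//.
rewrite l2_rnorm_sq; apply: limr_le.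
  exact: (@l2_sq R (x - L2 s_l2)).
by apply: nearW => n; exact: hA.
Qed.

HB.instance Definition _ := @Uniform_isComplete.Build l2 l2_cauchy_cvg.
HB.instance Definition _ := @isHilbert.Build R l2 (@l2_dot R) l2_normE.
End L2Complete.

Lemma l2_basis_subproof (R : realType) (i : nat) :
  (fun k => (k == i)%:R : R[i]) \in @sq_summable_pred R.
Proof.
apply/asboolP; apply: nondecreasing_is_cvgn.
  by apply: nondecreasing_series => k _ _; exact: sqr_ge0.
exists 1 => _ [n _ <-]; apply: (@le_trans _ _ (i < n)%N%:R); last by case: (i < n)%N.
rewrite /series/=; elim: n => [|n IH]; first by rewrite big_nil.
rewrite big_nat_recr//=; apply: le_trans (lerD IH (lexx _)) _.
rewrite rnorm_sq ltnS [(i <= n)%N]leq_eqVlt; have [->|_] := eqVneq i n.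
  by rewrite ltnn /= expr1n expr0n/= addr0 add0r.
by rewrite /= expr0n/= !addr0.
Qed.

Definition l2_basis (R : realType) (i : nat) : l2 R := L2 (l2_basis_subproof R i).

Section Operators.
Variables (R : realType) (E H : hilbertType R).

Definition separable_space : Prop := exists2 D : set H, countable D & dense D.

Definition orthocomplement (S : set E) : set E :=
  [set x | forall y, S y -> dotp x y = 0].

Definition orthonormal_basis (b : nat -> E) : Prop :=
  (forall i j, dotp (b i) (b j) = (i == j)%:R) /\
  (forall x, (forall i, dotp x (b i) = 0) -> x = 0).

Definition adjoint (F : E -> H) (Fs : H -> E) : Prop :=
  forall x y, dotp (F x) y = dotp x (Fs y).

(* In R[i], 0 <= z says that z is real and nonnegative. *)
Definition positive_operator (A : E -> E) : Prop :=
  forall x, 0 <= dotp (A x) x.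

(* A = (Fs F)^(1/2); when Fs is the adjoint of F, this is A = |F|. *)
Definition operator_abs (F : E -> H) (Fs : H -> E) (A : E -> E) : Prop :=
  [/\ continuous A, positive_operator A & forall x, A (A x) = Fs (F x)].

Definition partial_isometry (W : E -> H) (S : set E) (T : set H) : Prop :=
  [/\ forall x, S x -> rnorm (W x) = rnorm x,
      forall x, orthocomplement S x -> W x = 0 &
      range W = T].

Definition polar_decomposition (F W : E -> H) (A : E -> E) : Prop :=
  [/\ continuous W, forall x, F x = W (A x) &
      partial_isometry W (orthocomplement [set x | F x = 0]) (range F)].

Definition orthogonal_projection (S : set E) (P : E -> E) : Prop :=
  forall x, S (P x) /\ orthocomplement S (x - P x).

Local Open Scope ereal_scope.

(* The value does not depend on the choice of the orthonormal basis b. *)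
Definition hs_norm (b : nat -> E) (T : E -> E) : \bar R :=
  sqrte (\sum_(0 <= j <oo) (rnorm (T (b j)) ^+ 2)%:E).

Definition hilbert_schmidt (b : nat -> E) (T : E -> E) : Prop :=
  hs_norm b T < +oo.

End Operators.
Arguments separable_space {R} H.

Section Frames.
Variables (R : realType) (H : hilbertType R).
Implicit Types (K L : set H) (f g mu nu : nat -> H).

Definition hilbert_subspace K : Prop :=
  [/\ K 0, forall (c : R[i]) x y, K x -> K y -> K (c *: x + y) & closed K].

Definition frame_bounds (C D : R) K f : Prop :=
  forall x, K x ->
    ((C * rnorm x ^+ 2)%:E <= \sum_(0 <= j <oo) (rnorm (dotp x (f j)) ^+ 2)%:E)%E
    /\ (\sum_(0 <= j <oo) (rnorm (dotp x (f j)) ^+ 2)%:E <= (D * rnorm x ^+ 2)%:E)%E.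

Definition frame K f : Prop :=
  [/\ hilbert_subspace K, forall i, K (f i) &
      exists C D : R, [/\ 0 < C, 0 < D & frame_bounds C D K f]].

Definition normalized_tight_frame K f : Prop :=
  [/\ hilbert_subspace K, forall i, K (f i) & frame_bounds 1 1 K f].

(* T restricts to a bounded linear operator from K to L; its values outside K
   are irrelevant. *)
Definition bounded_operator_on K L (T : H -> H) : Prop :=
  [/\ forall x, K x -> L (T x),
      forall (c : R[i]) x y, K x -> K y -> T (c *: x + y) = c *: T x + T y &
      exists M : R, forall x, K x -> rnorm (T x) <= M * rnorm x].

Definition weakly_similar K f L g : Prop :=
  exists T S : H -> H,
    [/\ bounded_operator_on K L T, bounded_operator_on L K S,
        forall x, K x -> S (T x) = x, forall y, L y -> T (S y) = y &
        forall i, T (f i) = g i].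

Definition similar_frames K f g : Prop := weakly_similar K f K g.

Definition sq_dist f g : \bar R :=
  (\sum_(0 <= j <oo) (rnorm (f j - g j) ^+ 2)%:E)%E.

Definition symmetric_approximation K f L nu : Prop :=
  [/\ normalized_tight_frame L nu, weakly_similar K f L nu,
      forall M mu, normalized_tight_frame M mu -> weakly_similar K f M mu ->
        (sq_dist nu f <= sq_dist mu f)%E &
      (sq_dist nu f < +oo)%E].

End Frames.

(* Main.v *)
(* Extend a weakly similar normalized tight frame [mu] to the bounded operator
   [V e_j = mu_j]. It has the same kernel as [F], and tightness makes it a
   partial isometry, so [V^* V = W^* W = P]. Put [X = V - W], [A = |F|] and
   [Q = P - A]. From [F = W A],
     (V - F)^* = X^* + Q W^*,
   and expanding the square on an orthonormal basis [h] of [H] gives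
     ||V - F||^2 = ||Q||^2 + sum_k <A X^* h_k, X^* h_k>
                   + sum_k Re <X^* h_k, Q (V + W)^* h_k>
   in Hilbert-Schmidt norms. The last sum is the real part of the trace of the
   product of the self-adjoint [Q] and the skew-adjoint [(V + W)^* (V - W)],
   hence it vanishes. The middle sum is nonnegative as [A >= 0]; if it vanishes,
   then [A X^* = 0], and [X = 0] because [A] is injective on the range of [X^*]. *)

Require Import Defs.
From mathcomp Require Import all_boot all_order all_algebra sesquilinear complex.
From mathcomp Require Import ring lra.
From mathcomp Require Import boolp classical_sets functions cardinality reals.
From mathcomp Require Import ereal topology normedtype sequences esum.

Set Implicit Arguments.
Unset Strict Implicit.
Unset Printing Implicit Defensive.

Import Order.TTheory GRing.Theory Num.Theory.
Import numFieldNormedType.Exports.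

Local Open Scope classical_set_scope.
Local Open Scope complex_scope.
Local Open Scope ring_scope.

Local Notation Re := complex.Re.
Local Notation Im := complex.Im.

(** * Inner products *)

Section InnerProduct.
Variables (R : realType) (V : hilbertType R).
Implicit Types x y z : V.

(** The real part is symmetric and bilinear over [R], so expansions of squared norms reduce to real
    arithmetic. *)
Definition rdot x y : R := Re (dotp x y).

Lemma dotpC x y : dotp x y = (dotp y x)^*.
Proof. by rewrite [LHS]hermC expr0 mul1r. Qed.

Lemma dotpDl x y z : dotp (x + y) z = dotp x z + dotp y z.
Proof. exact: linearDl. Qed.

Lemma dotpBl x y z : dotp (x - y) z = dotp x z - dotp y z.
Proof. exact: linearBl. Qed.

Lemma dotpNl x y : dotp (- x) y = - dotp x y.
Proof. exact: linearNl. Qed.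

Lemma dotpZl c x y : dotp (c *: x) y = c * dotp x y.
Proof. exact: linearZl_LR. Qed.

Lemma dotpDr x y z : dotp x (y + z) = dotp x y + dotp x z.
Proof. exact: linearDr. Qed.

Lemma dotpBr x y z : dotp x (y - z) = dotp x y - dotp x z.
Proof. exact: linearBr. Qed.

Lemma dotpNr x y : dotp x (- y) = - dotp x y.
Proof. exact: linearNr. Qed.

Lemma dotpZr c x y : dotp x (c *: y) = c^* * dotp x y.
Proof. exact: linearZr_LR. Qed.

Lemma dotp0l x : dotp 0 x = 0.
Proof. exact: linear0l. Qed.

Lemma dotp0r x : dotp x 0 = 0.
Proof. exact: linear0r. Qed.

Lemma rdotC x y : rdot x y = rdot y x.
Proof. by rewrite /rdot dotpC conj_conjc; case: (dotp y x). Qed.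

Lemma ReD (c d : R[i]) : Re (c + d) = Re c + Re d.
Proof. by case: c; case: d. Qed.

Lemma ReN (c : R[i]) : Re (- c) = - Re c.
Proof. by case: c. Qed.

Lemma rdotDl x y z : rdot (x + y) z = rdot x z + rdot y z.
Proof. by rewrite /rdot dotpDl ReD. Qed.

Lemma rdotNl x y : rdot (- x) y = - rdot x y.
Proof. by rewrite /rdot dotpNl ReN. Qed.

Lemma rdotDr x y z : rdot x (y + z) = rdot x y + rdot x z.
Proof. by rewrite /rdot dotpDr ReD. Qed.

Lemma rdotNr x y : rdot x (- y) = - rdot x y.
Proof. by rewrite /rdot dotpNr ReN. Qed.

Lemma rdotZl (t : R) x y : rdot (t%:C *: x) y = t * rdot x y.
Proof. by rewrite /rdot dotpZl; case: (dotp x y) => a b /=; ring. Qed.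

Lemma rdotZr (t : R) x y : rdot x (t%:C *: y) = t * rdot x y.
Proof. by rewrite rdotC rdotZl rdotC. Qed.

Definition rdotE := (rdotDl, rdotDr, rdotNl, rdotNr).

Lemma norm_rnorm (U : normedZmodType R[i]) (x : U) : `|x| = (rnorm x)%:C.
Proof. by rewrite /rnorm RRe_real// ger0_real. Qed.

Lemma rnorm_nonneg (U : normedZmodType R[i]) (x : U) : 0 <= rnorm x.
Proof. by rewrite -ler0c -norm_rnorm. Qed.

Lemma rnorm_triangle (U : normedZmodType R[i]) (x y : U) :
  rnorm (x + y) <= rnorm x + rnorm y.
Proof. by rewrite -lecR rmorphD/= -!norm_rnorm ler_normD. Qed.

Lemma rnorm_distC (U : normedZmodType R[i]) (x y : U) :
  rnorm (x - y) = rnorm (y - x).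
Proof. by rewrite /rnorm distrC. Qed.

Lemma dotp_rnorm x : dotp x x = (rnorm x ^+ 2)%:C.
Proof. by rewrite -dotp_norm norm_rnorm rmorphXn. Qed.

Lemma rnorm_rdot x : rnorm x ^+ 2 = rdot x x.
Proof. by rewrite /rdot dotp_rnorm. Qed.

Lemma rdot_ge0 x : 0 <= rdot x x.
Proof. by rewrite -rnorm_rdot sqr_ge0. Qed.

Lemma rnorm_eq0 x : rnorm x = 0 -> x = 0.
Proof. by move=> h; apply/eqP; rewrite -normr_eq0 norm_rnorm h. Qed.

Lemma rdot_eq0 x : rdot x x = 0 -> x = 0.
Proof.
by rewrite -rnorm_rdot => /eqP; rewrite sqrf_eq0 => /eqP; exact: rnorm_eq0.
Qed.

Lemma eq_rdot x y : (forall z, rdot x z = rdot y z) -> x = y.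
Proof.
move=> h; apply/subr0_eq/rdot_eq0.
by rewrite rdotDl rdotNl h subrr.
Qed.

Lemma dotp_le x y : rnorm (dotp x y) <= rnorm x * rnorm y.
Proof.
have := dot_CauchySchwarz (@dotp R V) x y.
rewrite !dotp_rnorm norm_rnorm -rmorphXn -rmorphM lecR -exprMn.
by rewrite ler_sqr// nnegrE ?mulr_ge0// ?rnorm_nonneg.
Qed.

Lemma rdot_le x y : rdot x y <= rnorm x * rnorm y.
Proof.
apply: le_trans (dotp_le x y); apply: le_trans (rnorm_ge_Re _).
exact: ler_norm.
Qed.

Lemma cvg_rnormP (u : nat -> V) x :
  u @ \oo --> x <-> (fun n => rnorm (u n - x)) @ \oo --> (0 : R).
Proof.
split=> [ux|ux].
  apply/cvgrPdist_lt => e e0.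
  have e0' : 0 < e%:C by rewrite ltcR.
  move/cvgrPdist_lt : ux => /(_ _ e0'); apply: filterS => n; rewrite norm_rnorm ltcR rnorm_distC.
  by rewrite sub0r normrN ger0_norm// rnorm_nonneg.
apply/cvgrPdist_lt => e e0.
have er : e = (Re e)%:C by rewrite RRe_real// gtr0_real.
move: e0; rewrite er ltcR => e0.
move/cvgrPdist_lt : ux => /(_ _ e0); apply: filterS => n.
by rewrite norm_rnorm ltcR rnorm_distC sub0r normrN ger0_norm// rnorm_nonneg.
Qed.

Lemma cauchy_rnorm_cvg (u : nat -> V) :
  (forall e : R, 0 < e ->
     exists N, forall m, (N <= m)%N -> rnorm (u m - u N) <= e) ->
  exists x, u @ \oo --> x.
Proof.
move=> h; suff /cauchy_cvgP : cauchy (u @ \oo) by move/cvg_ex.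
apply: cauchy_exP => e e0.
have er : e = (Re e)%:C by rewrite RRe_real// gtr0_real.
move: e0; rewrite er ltcR => e0.
have [|N hN] := h (Re e / 2); first by rewrite divr_gt0.
exists (u N); exists N => // m /= Nm.
rewrite -ball_normE /= norm_rnorm ltcR rnorm_distC.
by apply: le_lt_trans (hN _ Nm) _; rewrite ltr_pdivrMr// mulr_natr mulr2n ltrDl.
Qed.

End InnerProduct.

(** * Parseval sequences *)

Section SquareNorms.
Variable R : realType.
Implicit Types U : normedZmodType R[i].

(** For [u j = X (e j)] with [e] an orthonormal basis, this is the squared Hilbert-Schmidt norm of
    [X], possibly infinite. *)
Definition norm2s U (u : nat -> U) : \bar R :=
  (\sum_(0 <= j <oo) (rnorm (u j) ^+ 2)%:E)%E.

Lemma norm2s_ge0 U (u : nat -> U) : (0 <= norm2s u)%E.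
Proof. by apply: nneseries_ge0 => n _ _; rewrite lee_fin sqr_ge0. Qed.

Lemma norm2sP U (u : nat -> U) (l : R) :
  norm2s u = l%:E <-> series (fun j => rnorm (u j) ^+ 2) @ \oo --> l.
Proof.
have E : (fun n => (series (fun j => rnorm (u j) ^+ 2) n)%:E) =
    (fun n => \sum_(0 <= j < n) (rnorm (u j) ^+ 2)%:E)%E.
  by apply/funext => n; rewrite /series/= sumEFin.
split=> h.
  apply: (@fine_cvg R nat \oo _ (fun n => (series (fun j => rnorm (u j) ^+ 2) n)%:E)).
  rewrite E -h; apply: is_cvg_nneseries => n _ _.
  by rewrite lee_fin sqr_ge0.
by rewrite /norm2s -E; apply: cvg_lim => //; apply: cvg_EFin => //; exact: nearW.
Qed.

Lemma norm2s_fin U (u : nat -> U) :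
  (norm2s u < +oo)%E -> exists2 l : R, 0 <= l & norm2s u = l%:E.
Proof.
move=> h; exists (fine (norm2s u)); first exact/fine_ge0/norm2s_ge0.
by rewrite fineK// ge0_fin_numE// norm2s_ge0.
Qed.

Lemma le_norm2s U U' (u : nat -> U) (v : nat -> U') :
  (forall j, rnorm (u j) <= rnorm (v j)) -> (norm2s u <= norm2s v)%E.
Proof.
move=> h; apply: lee_nneseries => n _; rewrite lee_fin ?sqr_ge0//.
by rewrite ler_sqr ?nnegrE ?rnorm_nonneg.
Qed.

Lemma eq_norm2s U U' (u : nat -> U) (v : nat -> U') :
  (forall j, rnorm (u j) = rnorm (v j)) -> norm2s u = norm2s v.
Proof. by move=> h; apply: eq_eseriesr => n _; rewrite h. Qed.

Lemma le_norm2sZ U U' (u : nat -> U) (v : nat -> U') (M : R) : 0 <= M ->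
  (forall j, rnorm (u j) <= M * rnorm (v j)) ->
  (norm2s v < +oo -> norm2s u < +oo)%E.
Proof.
move=> M0 h /norm2s_fin[l _ vl].
apply: (@le_lt_trans _ _ ((M ^+ 2)%:E * norm2s v)%E); last by rewrite vl ltry.
rewrite /norm2s -nneseriesZl; last by move=> i _; rewrite lee_fin sqr_ge0.
apply: lee_nneseries => n _; rewrite lee_fin ?sqr_ge0//.
by rewrite -exprMn ler_sqr ?nnegrE ?mulr_ge0 ?rnorm_nonneg.
Qed.

End SquareNorms.

(** Orthonormality is not demanded: zero vectors are allowed, so a finite-dimensional space also has
    such a sequence. *)
Definition parseval (R : realType) (V : hilbertType R) (h : nat -> V) : Prop :=
  forall x, norm2s (fun k => dotp x (h k)) = (rnorm x ^+ 2)%:E.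

Section Parseval.
Variables (R : realType) (V : hilbertType R) (b : nat -> V).

Definition partial_sum x n : V := \sum_(0 <= k < n) dotp x (b k) *: b k.

(* Vectors of norm 0 are allowed, so that a dense sequence can be
   orthonormalized without dropping terms. *)
Definition orthonormal_or_null : Prop :=
  (forall i j, i != j -> dotp (b i) (b j) = 0) /\
  (forall i, dotp (b i) (b i) *: b i = b i).

Hypothesis b_orth : orthonormal_or_null.

Lemma dotp_partial_sum x n i :
  dotp (partial_sum x n) (b i) = if (i < n)%N then dotp x (b i) else 0.
Proof.
(* Both cases at once: [b i] has norm 1, or it is null and both sides vanish. *)
have E : dotp x (b i) * dotp (b i) (b i) = dotp x (b i).
  rewrite -[in RHS](b_orth.2 i) dotpZr mulrC; congr (_ * _).
  by rewrite -dotpC.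
rewrite /partial_sum; elim: n => [|n IH]; first by rewrite big_nil dotp0l.
rewrite big_nat_recr//= dotpDl dotpZl IH ltnS (leq_eqVlt i n).
have [<-|ni] /= := eqVneq i n; first by rewrite ltnn add0r E.
by rewrite b_orth.1 1?eq_sym// mulr0 addr0.
Qed.

(** [y] is left free so that the formula serves for [x] itself and for any partial sum of [x] with
    at least [n] terms. *)
Lemma rdot_partial_sum x y n :
  (forall k, (k < n)%N -> dotp y (b k) = dotp x (b k)) ->
  rdot y (partial_sum x n) = \sum_(0 <= k < n) rnorm (dotp x (b k)) ^+ 2.
Proof.
rewrite /partial_sum; elim: n => [|n IH] h.
  by rewrite !big_nil /rdot dotp0r.
rewrite !big_nat_recr//= rdotDr IH; last by move=> k kn; exact/h/ltnW.
congr (_ + _); rewrite /rdot dotpZr h// rnorm_sq conj_conjc.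
by case: (dotp x (b n)) => p q /=; ring.
Qed.

Local Notation S x := (series (fun k => rnorm (dotp x (b k)) ^+ 2)).

Lemma rnorm_sub_partial_sum x m n : (n <= m)%N ->
  rnorm (partial_sum x m - partial_sum x n) ^+ 2 = S x m - S x n.
Proof.
move=> nm; rewrite rnorm_rdot !rdotE.
rewrite [rdot (partial_sum x n) (partial_sum x m)]rdotC.
rewrite !rdot_partial_sum; first by rewrite /series/=; ring.
- by move=> k kn; rewrite dotp_partial_sum kn.
- by move=> k kn; rewrite dotp_partial_sum (leq_trans kn nm).
- by move=> k kn; rewrite dotp_partial_sum kn.
Qed.

Lemma rnorm_sub_partial_sumr x n :
  rnorm (x - partial_sum x n) ^+ 2 = rnorm x ^+ 2 - S x n.
Proof.
rewrite !rnorm_rdot !rdotE [rdot (partial_sum x n) x]rdotC.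
rewrite !rdot_partial_sum//; last first.
  by move=> k kn; rewrite dotp_partial_sum kn.
by rewrite /series/=; ring.
Qed.

Lemma bessel_cvg {x} : cvgn (S x).
Proof.
apply: nondecreasing_is_cvgn.
  by apply: nondecreasing_series => k _ _; exact: sqr_ge0.
exists (rnorm x ^+ 2) => _ [n _ <-].
by rewrite -subr_ge0 -rnorm_sub_partial_sumr sqr_ge0.
Qed.

(** By Bessel's inequality the partial sums are Cauchy; their limit has the same coefficients as
    [x], so totality identifies the two. *)
Lemma cvg_partial_sum :
  (forall x, (forall i, dotp x (b i) = 0) -> x = 0) ->
  forall x, partial_sum x @ \oo --> x.
Proof.
move=> b_total x.
have [] := @cauchy_rnorm_cvg _ _ (partial_sum x).
  move=> e e0; have cS := bessel_cvg (x := x); move/cvgrPdist_le : (cS) => /(_ (e ^+ 2)).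
  rewrite exprn_gt0// => /(_ isT)[N _ hN]; exists N => m Nm.
  rewrite -ler_sqr ?nnegrE ?rnorm_nonneg ?(ltW e0)// rnorm_sub_partial_sum//.
  apply: le_trans (hN N (leqnn N)); apply: le_trans (ler_norm _).
  rewrite lerD2r; apply: nondecreasing_cvgn_le; last exact: cS.
  by apply: nondecreasing_series => k _ _; exact: sqr_ge0.
move=> s ss; suff {2}-> : x = s by exact: ss.
apply: subr0_eq; apply: b_total => i; apply/eqP; rewrite -normr_eq0 norm_rnorm.
suff -> : rnorm (dotp (x - s) (b i)) = 0 by [].
apply/eqP; rewrite eq_le rnorm_nonneg andbT.
move/cvg_rnormP : ss => ss.
have ss' : (fun n => rnorm (partial_sum x n - s) * rnorm (b i)) @ \oo --> (0 : R).
  by rewrite -(mul0r (rnorm (b i))); apply: cvgM => //; exact: cvg_cst.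
apply: (cvgr_to_ge ss'); exists i.+1 => // n /= ni.
apply: le_trans (dotp_le _ _).
by rewrite !dotpBl dotp_partial_sum ni.
Qed.

Lemma total_parseval :
  (forall x, (forall i, dotp x (b i) = 0) -> x = 0) -> parseval b.
Proof.
move=> b_total x; apply/norm2sP.
have /cvg_rnormP h := cvg_partial_sum b_total (x := x).
have -> : series (fun k => rnorm (dotp x (b k)) ^+ 2) = (fun n =>
    rnorm x ^+ 2 - rnorm (partial_sum x n - x) * rnorm (partial_sum x n - x)).
  apply/funext => n; rewrite -expr2 rnorm_distC rnorm_sub_partial_sumr; ring.
rewrite -[X in _ --> X]subr0 -[X in _ - X](mulr0 0).
by apply: cvgB; [exact: cvg_cst|exact: cvgM].
Qed.

End Parseval.

(** * Gram-Schmidt orthonormalization in a separable space *)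

Section GramSchmidt.
Variables (R : realType) (V : hilbertType R).
Implicit Types (b : nat -> V) (x : V).

(** As the inverse of 0 is 0, the zero vector is sent to itself; hence the null vectors in
    [orthonormal_or_null]. *)
Definition normalize x : V := ((rnorm x)^-1)%:C *: x.

Lemma normalizeK x : (rnorm x)%:C *: normalize x = x.
Proof.
rewrite /normalize scalerA -rmorphM/=; have [/eqP x0|x0] := boolP (rnorm x == 0).
  by rewrite (rnorm_eq0 x0) scaler0.
by rewrite mulfV// scale1r.
Qed.

Lemma dotp_normalize x : dotp (normalize x) (normalize x) *: normalize x = normalize x.
Proof.
rewrite dotp_rnorm rnorm_rdot /normalize rdotZl rdotZr -rnorm_rdot.
have [/eqP x0|x0] := boolP (rnorm x == 0); first by rewrite (rnorm_eq0 x0) !scaler0.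
by rewrite expr2 [_^-1 * (rnorm x * _)]mulKf// mulVf// scale1r.
Qed.

Lemma gram_schmidt (d : nat -> V) :
  exists b, forall n, b n = normalize (d n - partial_sum b (d n) n).
Proof.
pose next n (s : seq V) := normalize (d n - \sum_(v <- s) dotp (d n) v *: v).
pose gs := fix gs n := if n is m.+1 then rcons (gs m) (next m (gs m)) else [::].
exists (fun n => next n (gs n)) => n; congr (normalize (_ - _)).
suff h m (F : V -> V) : \sum_(v <- gs m) F v = \sum_(0 <= k < m) F (next k (gs k)).
  exact: h.
move: m F; elim=> [|m IH] F; first by rewrite big_nil big_nil.
by rewrite big_nat_recr//= -cats1 big_cat/= big_seq1 IH.
Qed.

Lemma gram_schmidt_orthonormal (d : nat -> V) b :
  (forall n, b n = normalize (d n - partial_sum b (d n) n)) -> orthonormal_or_null b.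
Proof.
move=> bE; split; last by move=> i; rewrite bE dotp_normalize.
suff h : forall n i j, (i < n)%N -> (j < n)%N -> i != j -> dotp (b i) (b j) = 0.
  by move=> i j; apply: (h (maxn i j).+1); rewrite ltnS ?leq_maxl ?leq_maxr.
elim=> // n IH.
have last_orth i : (i < n)%N -> dotp (b n) (b i) = 0.
  (* The induction hypothesis concerns the first [n] vectors only; padding them with zeros gives a
     full sequence to which [dotp_partial_sum] applies. *)
  move=> ni; pose b' k := if (k < n)%N then b k else 0.
  have b'_orth : orthonormal_or_null b'.
    split=> [j k jk|j]; rewrite /b'; last first.
      by case: ifP => _; [rewrite bE dotp_normalize|rewrite scaler0].
    case: ifP => jn; last by rewrite dotp0l.
    by case: ifP => kn; [exact: IH|rewrite dotp0r].
  have -> : b n = normalize (d n - partial_sum b' (d n) n).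
    rewrite bE; congr (normalize (_ - _)); apply: eq_big_nat => k /andP[_ kn].
    by rewrite /b' kn.
  have b'i : b i = b' i by rewrite /b' ni.
  rewrite /normalize dotpZl dotpBl b'i (dotp_partial_sum b'_orth) ni.
  by rewrite subrr mulr0.
move=> i j; rewrite !ltnS (leq_eqVlt i) (leq_eqVlt j) => /predU1P[->|ni] /predU1P[->|nj] ij.
- by rewrite eqxx in ij.
- exact: last_orth.
- by rewrite dotpC last_orth// conjC0.
- exact: IH.
Qed.

Lemma separable_parseval : separable_space V -> exists b, @parseval R V b.
Proof.
move=> [D /pfcard_geP Dcount Ddense].
have {Dcount} [d Dd] : exists d : nat -> V, D `<=` range d.
  case: Dcount => [->|[d]]; first by exists (fun=> 0).
  by exists d; exact: surj.
have [b bE] := gram_schmidt d; exists b.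
apply: total_parseval; first exact: (gram_schmidt_orthonormal bE).
move=> x xb.
have xd n : dotp x (d n) = 0.
  have psum0 y m : dotp x (partial_sum b y m) = 0.
    rewrite /partial_sum; elim: m => [|m IH]; first by rewrite big_nil dotp0r.
    by rewrite big_nat_recr//= dotpDr IH dotpZr xb mulr0 addr0.
  rewrite -(subrK (partial_sum b (d n) n) (d n)) dotpDr psum0 addr0.
  by rewrite -(normalizeK (d n - _)) -bE dotpZr xb mulr0.
(* If [x] were nonzero, density would put some [d n] at distance less than the norm of [x]. But
   [d n] is orthogonal to [x], so by Pythagoras it is at least that far. *)
apply/eqP; rewrite -normr_eq0; apply/negPn/negP => x0.
have e0 : 0 < `|x| by rewrite lt_neqAle normr_ge0 eq_sym x0.
have [|y [xy /Dd[n _ dn]]] := Ddense _ _ (ball_open x `|x|).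
  by exists x; exact: ballxx.
move: xy; rewrite -ball_normE /= -dn !norm_rnorm ltcR.
apply/negP; rewrite -leNgt -ler_sqr ?nnegrE ?rnorm_nonneg// !rnorm_rdot !rdotE.
have xd0 : rdot x (d n) = 0 by rewrite /rdot xd.
by rewrite [rdot (d n) x]rdotC xd0; have := rdot_ge0 (d n); lra.
Qed.

End GramSchmidt.

Lemma orthonormal_basis_or_null (R : realType) (V : hilbertType R) (b : nat -> V) :
  orthonormal_basis b -> orthonormal_or_null b.
Proof.
move=> [bo _]; split=> [i j /negbTE ij|i]; first by rewrite bo ij.
by rewrite bo eqxx scale1r.
Qed.

Section L2Basis.
Variable R : realType.
Local Notation e := (l2_basis R).

Lemma dotp_l2_basis (x : l2 R) i : dotp x (e i) = x i.
Proof.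
rewrite -[LHS]/(csum (fun n => x n * ((n == i)%:R)^*)).
have lim1 (g : R[i] -> R) : g 0 = 0 ->
    limn (series (fun n => g (x n * ((n == i)%:R)^*))) = g (x i).
  move=> g0; apply: lim_near_cst => //; exists i.+1 => // n /= ni.
  rewrite /series/= (bigD1_seq i) ?iota_uniq ?mem_index_iota//= eqxx conjC1 mulr1.
  rewrite big1 ?addr0// => j ji.
  by rewrite (negbTE ji) conjC0 mulr0.
by rewrite /csum !lim1//; case: (x i).
Qed.

Lemma l2_basis_orthonormal : orthonormal_basis e.
Proof.
split=> [i j|x x0]; first by rewrite dotp_l2_basis /= eq_sym.
by apply: val_inj; apply/funext => i; rewrite -[LHS]dotp_l2_basis x0.
Qed.

Lemma cvg_l2_partial_sum x : partial_sum e x @ \oo --> x.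
Proof.
apply: cvg_partial_sum; first exact/orthonormal_basis_or_null/l2_basis_orthonormal.
exact: l2_basis_orthonormal.2.
Qed.

End L2Basis.

(** * Hilbert-Schmidt norms and adjoints *)

Section HilbertSchmidt.
Variable R : realType.

Lemma parseval_onb (V : hilbertType R) (b : nat -> V) :
  orthonormal_basis b -> parseval b.
Proof.
by move=> hb; apply: total_parseval; [exact: orthonormal_basis_or_null|exact: hb.2].
Qed.

(** Parseval turns both sides into the double series of [|<X e_j, h_k>|^2], summed in the two
    orders. *)
Lemma norm2s_adjoint (E V : hilbertType R) (X : E -> V) (Xs : V -> E) e h :
  parseval e -> parseval h -> adjoint X Xs ->
  norm2s (fun j => X (e j)) = norm2s (fun k => Xs (h k)).
Proof.
move=> pe ph adj; rewrite /norm2s.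
under eq_eseriesr do rewrite -(ph (X _)).
under [RHS]eq_eseriesr do rewrite -(pe (Xs _)).
rewrite /norm2s nneseries_interchange; last by move=> *; rewrite lee_fin sqr_ge0.
apply: eq_eseriesr => k _; apply: eq_eseriesr => j _.
by rewrite adj dotpC rnorm_conj.
Qed.

Lemma norm2s_lincomb_fin (V : hilbertType R) (u v w : nat -> V) (a b : R) :
  (forall j, w j = a%:C *: u j + b%:C *: v j) ->
  (norm2s u < +oo -> norm2s v < +oo -> norm2s w < +oo)%E.
Proof.
move=> wE /norm2s_fin[l _ ul] /norm2s_fin[m _ vm].
apply: (@le_lt_trans _ _ ((2 * a ^+ 2)%:E * norm2s u + (2 * b ^+ 2)%:E * norm2s v)%E).
  rewrite /norm2s -!nneseriesZl; [|by move=> i _; rewrite lee_fin sqr_ge0..].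
  have coef_ge0 (c : R) (z : nat -> V) i : (0 <= (2 * c ^+ 2)%:E * (rnorm (z i) ^+ 2)%:E)%E.
    rewrite -EFinM lee_fin; apply: mulr_ge0; last exact: sqr_ge0.
    by apply: mulr_ge0; [exact: ler0n|exact: sqr_ge0].
  rewrite -nneseriesD//.
  apply: lee_nneseries => n _; first by rewrite lee_fin sqr_ge0.
  rewrite -!EFinM -EFinD lee_fin wE !rnorm_rdot !rdotE !rdotZl !rdotZr.
  rewrite [rdot (v n) (u n)]rdotC.
  have := rdot_ge0 (a%:C *: u n - b%:C *: v n).
  rewrite !rdotE !rdotZl !rdotZr [rdot (v n) (u n)]rdotC.
  lra.
by rewrite ul vm -!EFinM -EFinD ltry.
Qed.

(** Polarization. The limit is expressed through [norm2s] so that [norm2s_adjoint] can carry it to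
    another basis. *)
Lemma cvg_series_rdot (V : hilbertType R) (u v : nat -> V) :
  (norm2s u < +oo)%E -> (norm2s v < +oo)%E ->
  series (fun j => rdot (u j) (v j)) @ \oo -->
  (fine (norm2s (fun j => u j + v j)) - fine (norm2s (fun j => u j - v j))) / 4.
Proof.
move=> uf vf.
have [] := @norm2s_fin R V (fun j => u j + v j).
  apply: (norm2s_lincomb_fin (a := 1) (b := 1) _ uf vf) => j.
  by rewrite !scale1r.
move=> s _ sE.
have [] := @norm2s_fin R V (fun j => u j - v j).
  apply: (norm2s_lincomb_fin (a := 1) (b := -1) _ uf vf) => j.
  by rewrite rmorphN scaleN1r scale1r.
move=> t _ tE; rewrite sE tE /=.
have -> : series (fun j => rdot (u j) (v j)) = (fun n =>
    (series (fun j => rnorm (u j + v j) ^+ 2) n -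
     series (fun j => rnorm (u j - v j) ^+ 2) n) * 4^-1).
  apply/funext => n; rewrite /series/= -sumrB mulr_suml; apply: eq_bigr => j _.
  rewrite !rnorm_rdot !rdotE [rdot (v j) (u j)]rdotC; lra.
by apply: cvgM; [apply: cvgB; exact/norm2sP|exact: cvg_cst].
Qed.

(** The traces of [Y^* X] and [Y X^*] have the same real part: by polarization this is
    [norm2s_adjoint] for [X + Y] and [X - Y]. *)
Lemma hs_rdot_adjoint (E V : hilbertType R) (X Y : E -> V) (Xs Ys : V -> E) e h :
  parseval e -> parseval h -> adjoint X Xs -> adjoint Y Ys ->
  (norm2s (fun j => X (e j)) < +oo -> norm2s (fun j => Y (e j)) < +oo ->
   exists2 l : R, series (fun j => rdot (X (e j)) (Y (e j))) @ \oo --> l &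
     series (fun k => rdot (Xs (h k)) (Ys (h k))) @ \oo --> l)%E.
Proof.
move=> pe ph aX aY Xf Yf; eexists; first exact: cvg_series_rdot.
rewrite (@norm2s_adjoint _ _ (fun x => X x + Y x) (fun y => Xs y + Ys y) _ h)//; last first.
  by move=> x y; rewrite dotpDl dotpDr aX aY.
rewrite (@norm2s_adjoint _ _ (fun x => X x - Y x) (fun y => Xs y - Ys y) _ h)//; last first.
  by move=> x y; rewrite dotpBl dotpBr aX aY.
by apply: cvg_series_rdot; rewrite -?(norm2s_adjoint pe ph aX) -?(norm2s_adjoint pe ph aY).
Qed.

End HilbertSchmidt.

(** * Bounded linear maps, and adjoints of maps defined on [l2] *)

Section BoundedLinear.
Variable R : realType.

Definition bounded_linear (E V : hilbertType R) (X : E -> V) : Prop :=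
  (forall c x y, X (c *: x + y) = c *: X x + X y) /\
  exists2 M : R, 0 <= M & forall x, rnorm (X x) <= M * rnorm x.

Section Algebra.
Variables (E V : hilbertType R) (X : E -> V).
Hypothesis bX : bounded_linear X.

Lemma blinD x y : X (x + y) = X x + X y.
Proof. by rewrite -[x]scale1r bX.1 !scale1r. Qed.

Lemma blin0 : X 0 = 0.
Proof. by apply: (addrI (X 0)); rewrite -blinD !addr0. Qed.

Lemma blinZ c x : X (c *: x) = c *: X x.
Proof. by rewrite -[c *: x]addr0 bX.1 blin0 addr0. Qed.

Lemma blinN x : X (- x) = - X x.
Proof. by rewrite -scaleN1r blinZ scaleN1r. Qed.

Lemma blinB x y : X (x - y) = X x - X y.
Proof. by rewrite blinD blinN. Qed.

Lemma blin_cvg (u : nat -> E) x : u @ \oo --> x -> (fun n => X (u n)) @ \oo --> X x.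
Proof.
have [_ [M M0 XM]] := bX.
move=> /cvg_rnormP ux; apply/cvg_rnormP.
apply: (@squeeze_cvgr _ _ _ _ (fun=> 0) (fun n => M * rnorm (u n - x))).
- by apply: nearW => n; rewrite rnorm_nonneg -blinB XM.
- exact: cvg_cst.
- by rewrite -(mulr0 M); apply: cvgM => //; exact: cvg_cst.
Qed.

End Algebra.

Lemma continuous_bounded_linear (E V : hilbertType R) (X : {linear E -> V}) :
  continuous X -> bounded_linear X.
Proof.
move=> /linear_bounded_continuous/linear_boundedP/pinfty_ex_gt0[M M0 XM].
split; first exact: linearP.
have er : M = (Re M)%:C by rewrite RRe_real// gtr0_real.
exists (Re M); first by rewrite -ler0c -er ltW.
by move=> x; have := XM x; rewrite !norm_rnorm {1}er -rmorphM lecR.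
Qed.

Lemma subspace_lincomb (V : hilbertType R) (K : set V) n (c : nat -> R[i]) u :
  hilbert_subspace K -> (forall k, K (u k)) -> K (\sum_(0 <= k < n) c k *: u k).
Proof.
move=> [K0 KP _] Ku; elim: n => [|n IH]; first by rewrite big_nil.
by rewrite big_nat_recr//= addrC; apply: KP.
Qed.

Section OnL2.
Variables (V : hilbertType R) (X : l2 R -> V).
Hypothesis bX : bounded_linear X.
Local Notation e := (l2_basis R).

Lemma blin_sum n (c : nat -> R[i]) (u : nat -> l2 R) :
  X (\sum_(0 <= k < n) c k *: u k) = \sum_(0 <= k < n) c k *: X (u k).
Proof.
elim: n => [|n IH]; first by rewrite !big_nil blin0.
by rewrite !big_nat_recr//= blinD// IH blinZ.
Qed.

Lemma blin_range (K : set V) :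
  hilbert_subspace K -> (forall i, K (X (e i))) -> forall x, K (X x).
Proof.
move=> hK Ke x; have [_ _ clK] := hK.
apply: (closed_cvg _ clK _ _ (blin_cvg bX (cvg_l2_partial_sum (x := x)))).
by apply: nearW => n; rewrite /partial_sum blin_sum; exact: subspace_lincomb.
Qed.

Lemma l2_dual_seq_sq y : (fun j => dotp y (X (e j))) \in @sq_summable_pred R.
Proof.
have [_ [M M0 XM]] := bX.
apply/asboolP/nondecreasing_is_cvgn.
  by apply: nondecreasing_series => k _ _; exact: sqr_ge0.
exists ((rnorm y * M) ^+ 2) => _ [n _ <-].
pose c j := dotp y (X (e j)).
(* [w n] truncates the vector that the adjoint must assign to [y]. Both its squared norm and
   [rdot y (X (w n))] equal [s], so [||w n||^2 <= ||y|| M ||w n||]. *)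
pose w m := \sum_(0 <= j < m) c j *: e j.
set s := series _ n.
have s0 : 0 <= s by rewrite /s /series/= sumr_ge0// => *; exact: sqr_ge0.
have ws : rnorm (w n) ^+ 2 = s.
  rewrite /s /w rnorm_rdot /series/=.
  have we m k : (m <= k)%N -> dotp (w m) (e k) = 0.
    elim: m => [|m IH] mk; first by rewrite /w big_nil dotp0l.
    rewrite /w big_nat_recr//= dotpDl -/(w m) IH 1?ltnW// dotpZl.
    by rewrite (l2_basis_orthonormal R).1 (ltn_eqF mk) mulr0 addr0.
  elim: n {s s0} => [|n IH]; first by rewrite !big_nil /rdot dotp0l.
  rewrite !big_nat_recr//= !rdotE IH [rdot (_ *: _) (\sum_(_ <= _ < _) _)]rdotC.
  rewrite {1 2}/rdot dotpZr we// mulr0 /rdot dotpZl dotpZr.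
  rewrite (l2_basis_orthonormal R).1 eqxx mulr1 rnorm_sq conj_conjc /c.
  by case: (dotp y _) => p q /=; ring.
have ys : rdot y (X (w n)) = s.
  rewrite /w blin_sum /s /series/=.
  elim: (n) => [|m IH]; first by rewrite !big_nil /rdot dotp0r.
  rewrite !big_nat_recr//= rdotDr IH; congr (_ + _).
  rewrite /rdot dotpZr rnorm_sq conj_conjc /c.
  by case: (dotp y _) => p q /=; ring.
have t0 := rnorm_nonneg (w n); have y0 := rnorm_nonneg y.
have : s <= rnorm y * M * rnorm (w n).
  rewrite -ys; apply: le_trans (rdot_le _ _) _.
  by rewrite -mulrA ler_wpM2l.
rewrite -ws => h.
have {}h : rnorm (w n) <= rnorm y * M.
  have [->|wn] := eqVneq (rnorm (w n)) 0; first exact: mulr_ge0.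
  by rewrite expr2 ler_pM2r// in h; rewrite lt_neqAle eq_sym wn.
by rewrite ler_sqr// nnegrE mulr_ge0.
Qed.

(** The sequence [<y, X e_j>] is the value at [y]. The identity holds on partial sums of [x], and
    boundedness carries it to the limit. *)
Lemma l2_adjoint : exists Xs, adjoint X Xs.
Proof.
exists (fun y => L2 (l2_dual_seq_sq y)) => x y; set z := L2 _.
apply: subr0_eq; have [_ [M M0 XM]] := bX.
have d0 n : dotp (X (partial_sum e x n)) y - dotp (partial_sum e x n) z = 0.
  rewrite /partial_sum blin_sum; elim: n => [|n IH].
    by rewrite !big_nil !dotp0l subrr.
  rewrite !big_nat_recr//= !dotpDl opprD addrACA IH add0r !dotpZl -mulrBr.
  by rewrite [dotp (e n) z]dotpC dotp_l2_basis /= -dotpC subrr mulr0.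
apply/eqP; rewrite -normr_eq0 norm_rnorm; set r := rnorm _.
suff -> : r = 0 by [].
apply/eqP; rewrite eq_le rnorm_nonneg andbT.
have h : (fun n => (M * rnorm y + rnorm z) * rnorm (partial_sum e x n - x))
    @ \oo --> (0 : R).
  rewrite -(mulr0 (M * rnorm y + rnorm z)); apply: cvgM; first exact: cvg_cst.
  exact/cvg_rnormP/cvg_l2_partial_sum.
apply: (cvgr_to_ge h); apply: nearW => n; rewrite /r.
have -> : dotp (X x) y - dotp x z =
    dotp (X (x - partial_sum e x n)) y - dotp (x - partial_sum e x n) z.
  by rewrite blinB// !dotpBl (subr0_eq (d0 n)); ring.
apply: le_trans (rnormD _ _) _; rewrite mulrDl lerD//.
  apply: le_trans (dotp_le _ _) _; rewrite mulrAC ler_wpM2r ?rnorm_nonneg//.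
  by rewrite rnorm_distC XM.
rewrite {1}/rnorm normrN -/(rnorm _); apply: le_trans (dotp_le _ _) _.
by rewrite mulrC rnorm_distC.
Qed.

End OnL2.
End BoundedLinear.

(** * Adjoints, isometries and positive operators *)

Section Adjoints.
Variable R : realType.

Lemma eq_dotp (V : hilbertType R) (x y : V) :
  (forall z, dotp z x = dotp z y) -> x = y.
Proof. by move=> h; apply: eq_rdot => z; rewrite rdotC [RHS]rdotC /rdot h. Qed.

Section Adjoint.
Variables (E V : hilbertType R) (X : E -> V) (Xs : V -> E).
Hypothesis adjX : adjoint X Xs.

Lemma adjoint_sym : adjoint Xs X.
Proof. by move=> y x; rewrite dotpC -adjX -dotpC. Qed.

Lemma adjoint_rdot x y : rdot (X x) y = rdot x (Xs y).
Proof. by rewrite /rdot adjX. Qed.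

Lemma adjoint_linear c x y : Xs (c *: x + y) = c *: Xs x + Xs y.
Proof. by apply: eq_dotp => z; rewrite -adjX !dotpDr !dotpZr -!adjX. Qed.

Lemma adjoint_bounded (M : R) : 0 <= M ->
  (forall x, rnorm (X x) <= M * rnorm x) -> forall y, rnorm (Xs y) <= M * rnorm y.
Proof.
move=> M0 XM y; have [->|y0] := eqVneq (rnorm (Xs y)) 0.
  by rewrite mulr_ge0 ?rnorm_nonneg.
have pos : 0 < rnorm (Xs y) by rewrite lt_neqAle eq_sym y0 rnorm_nonneg.
rewrite -(ler_pM2r pos) -expr2 rnorm_rdot -adjoint_rdot.
apply: le_trans (rdot_le _ _) _; rewrite mulrAC ler_wpM2r ?rnorm_nonneg//.
Qed.

Lemma adjoint_bounded_linear : bounded_linear X -> bounded_linear Xs.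
Proof.
by move=> [_ [M M0 XM]]; split; [exact: adjoint_linear|exists M; last exact: adjoint_bounded].
Qed.

End Adjoint.

(** Polarization at a single pair, so that it applies to maps isometric on a subspace only. *)
Lemma isometry_rdot (E V : hilbertType R) (X : E -> V) x y :
  X (x + y) = X x + X y -> rnorm (X x) = rnorm x -> rnorm (X y) = rnorm y ->
  rnorm (X (x + y)) = rnorm (x + y) -> rdot (X x) (X y) = rdot x y.
Proof.
move=> XD Ix Iy; rewrite XD => /(congr1 (fun t => t ^+ 2)).
move: Ix Iy => /(congr1 (fun t => t ^+ 2)) + /(congr1 (fun t => t ^+ 2)).
rewrite !rnorm_rdot !rdotE [rdot y x]rdotC [rdot (X y) (X x)]rdotC.
lra.
Qed.

Section Positive.
Variables (E : hilbertType R) (A : {linear E -> E}).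
Hypothesis A_pos : positive_operator A.

Lemma positive_adjoint : adjoint A A.
Proof.
move=> x y; rewrite [RHS]dotpC.
(* The quadratic form of [A] is real at [z], [w] and [z + c *: w]. Then [c = 1] yields the imaginary
   part of the identity and [c = i] its real part. *)
have imP c z w : Im (c^* * dotp (A z) w + c * dotp (A w) z) = 0.
  have := A_pos (z + c *: w); have := A_pos z; have := A_pos w.
  rewrite linearD linearZ/= !dotpDl !dotpDr !dotpZl !dotpZr !lecE/=.
  case: (dotp (A z) z) => ? a; case: (dotp (A w) w) => ? b.
  rewrite conj_conjc; case: (c) => p q; case: (dotp (A z) w) => r s.
  case: (dotp (A w) z) => t u /= /andP[/eqP -> _] /andP[/eqP -> _] /andP[/eqP h _].
  by move: h; rewrite ?mulr0 ?mul0r => h; nra.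
have := imP 1 x y; have := imP 'i x y; rewrite !conj_conjc.
case: (dotp (A x) y) => p q; case: (dotp (A y) x) => r s /=.
by move=> h1 h2; congr (_ +i* _); lra.
Qed.

Lemma positive_rdot_ge0 x : 0 <= rdot (A x) x.
Proof. by have := A_pos x; rewrite lecE => /andP[]. Qed.

Lemma positive_rdot_eq0 x : rdot (A x) x = 0 -> A x = 0.
Proof.
move=> Ax0; apply: rdot_eq0; set a := rdot (A x) (A x).
set c := rdot (A (A x)) (A x).
have c0 : 0 <= c by exact: positive_rdot_ge0.
have h (t : R) : 0 <= t * a * 2 + t ^+ 2 * c.
  have := positive_rdot_ge0 (x + t%:C *: A x).
  rewrite linearD linearZ/= !rdotE !rdotZl !rdotZr Ax0.
  rewrite (adjoint_rdot positive_adjoint (A x) x) -/a -/c.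
  lra.
have a0 : 0 <= a by exact: rdot_ge0.
apply/eqP; rewrite eq_le a0 andbT leNgt; apply/negP => a_gt0.
(* A negative [t] small enough for the linear term of [h] to dominate; the shift by 1 keeps the
   denominator positive when [c = 0]. *)
have := h (- (a / (c + 1))).
have -> : - (a / (c + 1)) * a * 2 + (- (a / (c + 1))) ^+ 2 * c =
   - ((a / (c + 1)) ^+ 2 * (c + 2)).
  by field; rewrite gt_eqF// ltr_wpDl.
apply/negP; rewrite -ltNge oppr_lt0 mulr_gt0 ?exprn_gt0 ?divr_gt0// ltr_wpDl//.
Qed.

End Positive.

Lemma closure_orthogonal (V : hilbertType R) (S : set V) n x :
  (forall z, S z -> dotp z n = 0) -> closure S x -> dotp x n = 0.
Proof.
move=> Sn Sx; apply/eqP; rewrite -normr_eq0 norm_rnorm; apply/negPn/negP => d0.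
have {}d0 : 0 < rnorm (dotp x n).
  by rewrite lt_neqAle rnorm_nonneg andbT eq_sym -(inj_eq (@complexI R)).
have n1 : 0 < rnorm n + 1 by rewrite ltr_wpDl ?rnorm_nonneg.
have e0 : 0 < (rnorm (dotp x n) / (rnorm n + 1))%:C by rewrite ltcR divr_gt0.
have [z [Sz]] := Sx _ (nbhsx_ballx x _ e0).
rewrite -ball_normE /= norm_rnorm ltcR => xz.
have := dotp_le (x - z) n; rewrite dotpBl (Sn z Sz) subr0.
have := rnorm_nonneg n; have := rnorm_nonneg (x - z).
move: xz; rewrite ltr_pdivlMr//; lra.
Qed.

End Adjoints.

(** * Normalized tight frames *)

Section TightFrame.
Variables (R : realType) (H : hilbertType R) (L : set H) (mu : nat -> H).
Variables (V : l2 R -> H) (Vs : H -> l2 R).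
Local Notation e := (l2_basis R).
Hypotheses (mu_tight : normalized_tight_frame L mu) (bV : bounded_linear V).
Hypotheses (V_basis : forall j, V (e j) = mu j) (adjV : adjoint V Vs).

(** The coordinates of [Vs y] are the frame coefficients [<y, mu_j>]. *)
Lemma analysis_norm2s y : norm2s (fun j => dotp y (mu j)) = (rnorm (Vs y) ^+ 2)%:E.
Proof.
rewrite -(parseval_onb (l2_basis_orthonormal R)); apply: eq_norm2s => j.
by rewrite -V_basis -(adjoint_sym adjV).
Qed.

Lemma tight_analysis_isometry y : L y -> rnorm (Vs y) = rnorm y.
Proof.
have [_ _ hmu] := mu_tight => /hmu; rewrite mul1r -/(norm2s _) analysis_norm2s.
rewrite !lee_fin => -[h1 h2]; apply/eqP.
by rewrite -(@eqrXn2 _ 2)// ?rnorm_nonneg// eq_le h1 h2.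
Qed.

Lemma tight_synthesis_range x : L (V x).
Proof.
have [hL muL _] := mu_tight.
by apply: (blin_range bV hL) => j; rewrite V_basis.
Qed.

(** [Vs] is isometric on [L], hence preserves real inner products there. For [z = V (Vs y) - y],
    itself in [L], this gives [<V Vs y, z> = <Vs y, Vs z> = <y, z>], so [z] is orthogonal to
    itself. *)
Lemma tight_reconstruction y : L y -> V (Vs y) = y.
Proof.
move=> Ly; have [[_ LP _] _ _] := mu_tight.
have LD u v : L u -> L v -> L (u + v).
  by move=> Lu Lv; rewrite -[u]scale1r; exact: LP.
have VsD u v : Vs (u + v) = Vs u + Vs v.
  by have := adjoint_linear adjV 1 u v; rewrite !scale1r.
apply: subr0_eq; set z := V (Vs y) - y.
have Lz : L z.
  rewrite /z addrC -scaleN1r; apply: LP => //; exact: tight_synthesis_range.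
apply: rdot_eq0; rewrite {1}/z rdotDl rdotNl (adjoint_rdot adjV).
rewrite (isometry_rdot (VsD _ _)) ?subrr//; apply: tight_analysis_isometry => //.
exact: LD.
Qed.

End TightFrame.

(** * Polar decomposition and approximation *)

Section Polar.
Variables (R : realType) (H : hilbertType R) (K : set H) (f : nat -> H).
Variables (F W : {linear l2 R -> H}) (Fs : {linear H -> l2 R}).
Variables (A P : {linear l2 R -> l2 R}).
Local Notation e := (l2_basis R).
Hypotheses (f_frame : frame K f) (F_continuous : continuous F).
Hypotheses (F_basis : forall i, F (e i) = f i) (F_adjoint : adjoint F Fs).
Hypotheses (F_abs : operator_abs F Fs A) (F_polar : polar_decomposition F W A).
Hypothesis P_proj : orthogonal_projection (closure (range (fun x => Fs (F x)))) P.

Let A_pos : positive_operator A. Proof. by have [] := F_abs. Qed.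
Let A_sq x : A (A x) = Fs (F x). Proof. by have [_ _] := F_abs; apply. Qed.
Let bF : bounded_linear F. Proof. exact: continuous_bounded_linear. Qed.
Let bW : bounded_linear W.
Proof. by apply: continuous_bounded_linear; have [] := F_polar. Qed.
Let FE x : F x = W (A x). Proof. by have [_] := F_polar. Qed.
Let A_adj : adjoint A A. Proof. exact: positive_adjoint. Qed.

Lemma rnorm_abs x : rnorm (A x) = rnorm (F x).
Proof.
apply/eqP; rewrite -(@eqrXn2 _ 2) ?rnorm_nonneg// !rnorm_rdot.
by rewrite (adjoint_rdot A_adj) A_sq -(adjoint_rdot F_adjoint).
Qed.

Lemma abs_ker n : F n = 0 -> A n = 0.
Proof. by move=> Fn; apply: rnorm_eq0; rewrite rnorm_abs Fn /rnorm normr0. Qed.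

(** * The kernel of [F] and the projection [P] *)

Let N := [set x | F x = 0].

Lemma proj_perp x : orthocomplement N (P x).
Proof.
move=> n Fn; apply: closure_orthogonal (P_proj x).1 => _ [y _ <-].
by rewrite (adjoint_sym F_adjoint) Fn dotp0r.
Qed.

(** [x - P x] is orthogonal to its own image under [F^* F]. *)
Lemma proj_ker x : F (x - P x) = 0.
Proof.
apply: rdot_eq0; rewrite (adjoint_rdot F_adjoint) /rdot.
by rewrite (P_proj x).2//; apply: subset_closure; exists (x - P x).
Qed.

Lemma proj_F x : F (P x) = F x.
Proof. by apply/esym/subr0_eq; rewrite -linearB proj_ker. Qed.

Lemma perp_ker_eq0 x : orthocomplement N x -> F x = 0 -> x = 0.
Proof. by move=> h Fx; apply: rdot_eq0; rewrite /rdot h. Qed.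

(** [F] is injective on the orthogonal complement of its kernel; this is how [Vs V] is later
    recognized as [P]. *)
Lemma proj_unique x y : orthocomplement N y -> F y = F x -> P x = y.
Proof.
move=> hy Fyx; apply: subr0_eq; apply: perp_ker_eq0.
  by move=> n Fn; rewrite dotpBl hy// proj_perp// subrr.
by rewrite linearB/= proj_F Fyx subrr.
Qed.

Lemma proj_A x : A (P x) = A x.
Proof. by apply/esym/subr0_eq; rewrite -linearB abs_ker// proj_ker. Qed.

Lemma proj_W x : W (P x) = W x.
Proof.
apply/esym/subr0_eq; rewrite -linearB.
have [_ _ [_ W0 _]] := F_polar; apply: W0 => y hy.
by rewrite dotpC hy ?conjC0//; exact: proj_ker.
Qed.

Lemma proj_dotp x y : dotp (P x) (P y) = dotp (P x) y.
Proof.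
apply: subr0_eq; rewrite -dotpBr -opprB dotpNr.
by rewrite proj_perp ?oppr0//; exact: proj_ker.
Qed.

Lemma proj_adjoint : adjoint P P.
Proof. by move=> x y; rewrite -proj_dotp dotpC proj_dotp -dotpC. Qed.

Lemma W_isometry x : rnorm (W x) = rnorm (P x).
Proof.
have [_ _ [WI _ _]] := F_polar.
by rewrite -proj_W WI//; exact: proj_perp.
Qed.

Lemma range_sub_K x : K (F x).
Proof.
have [hK fK _] := f_frame.
by apply: (blin_range bF hK) => j; rewrite F_basis.
Qed.

Lemma frame_total x : K x -> (forall j, dotp x (f j) = 0) -> x = 0.
Proof.
have [_ _ [C [D [C0 _ hf]]]] := f_frame.
move=> /hf[+ _] x0; under eq_eseriesr do rewrite x0 /rnorm normr0 expr0n.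
rewrite eseries0// lee_fin => h; apply: rnorm_eq0.
have := rnorm_nonneg x; move: h; rewrite le_eqVlt pmulr_rlt0// ltNge sqr_ge0 orbF.
by rewrite mulf_eq0 gt_eqF//= sqrf_eq0 => /eqP.
Qed.

(** * The tight frame [W (e i)] and its similarity to [f] *)

Section Adjoint.
Variable Ws : H -> l2 R.
Hypothesis W_adj : adjoint W Ws.

Lemma proj_id y : orthocomplement N y -> P y = y.
Proof. by move=> hy; exact: proj_unique. Qed.

Lemma adj_W_W x : Ws (W x) = P x.
Proof.
apply: eq_rdot => z; rewrite (adjoint_rdot (adjoint_sym W_adj)).
have iso u : rnorm (W (P u)) = rnorm (P u) by rewrite proj_W W_isometry.
rewrite -(proj_W x) -(proj_W z).
rewrite (isometry_rdot (raddfD W (P x) (P z)) (iso x) (iso z)).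
  by rewrite /rdot proj_dotp.
by rewrite -(raddfD P x z) iso.
Qed.

(** [Vs V = P] forces [V] to vanish on the kernel of [F]. *)
Lemma adj_perp (V : l2 R -> H) (Vs : H -> l2 R) y : adjoint V Vs ->
  (forall x, Vs (V x) = P x) -> orthocomplement N (Vs y).
Proof.
move=> adjV VsV n Fn; rewrite (adjoint_sym adjV).
suff -> : V n = 0 by rewrite dotp0r.
apply: rdot_eq0; rewrite (adjoint_rdot adjV) VsV.
by rewrite (@proj_unique n 0) ?/rdot ?dotp0r// ?linear0// => m _; rewrite dotp0l.
Qed.

Lemma adj_F y : Fs y = A (Ws y).
Proof.
apply: eq_dotp => x; rewrite -F_adjoint FE W_adj.
by rewrite A_adj.
Qed.

Lemma range_W_K x : K (W x).
Proof.
have [_ _ [_ _ rW]] := F_polar; have : range W (W x) by exists x.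
by rewrite rW => -[y _ <-]; exact: range_sub_K.
Qed.

(** The difference lies in [K] and is orthogonal to every [f_j = W (A e_j)], because [Ws W = P]
    fixes [A e_j]. *)
Lemma W_reconstruction y : K y -> W (Ws y) = y.
Proof.
move=> Ky; apply: subr0_eq; apply: frame_total.
  have [[_ KP _] _ _] := f_frame.
  by rewrite addrC -scaleN1r; apply: KP => //; exact: range_W_K.
move=> j; rewrite dotpBl -F_basis FE W_adj adj_W_W -(adjoint_sym W_adj).
rewrite [P (A _)]proj_id ?subrr// => n Fn.
by rewrite A_adj abs_ker// dotp0r.
Qed.

Lemma W_adj_isometry y : K y -> rnorm (Ws y) = rnorm y.
Proof.
move=> Ky; rewrite -[in RHS](W_reconstruction Ky) W_isometry proj_id//.
exact: adj_perp W_adj adj_W_W.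
Qed.

Lemma W_tight : normalized_tight_frame K (fun i => W (e i)).
Proof.
have [hK _ _] := f_frame; split=> // [i|x Kx]; first exact: range_W_K.
rewrite -/(norm2s _) (analysis_norm2s (fun=> erefl) W_adj) W_adj_isometry// !mul1r.
by split.
Qed.

(** The inverse similarity is explicit: [S = F Ws] sends [W e_i] to [F (P e_i) = f_i]. The required
    [T] is the inverse of [S] on [K]. *)
Lemma W_similar : similar_frames K f (fun i => W (e i)).
Proof.
have [[K0 KP _] fK [C [D [C0 _ hf]]]] := f_frame.
have [MF MF0 hF] := bF.2; have [MW MW0 hW] := bW.2.
have Ws_bd := adjoint_bounded W_adj MW0 hW.
pose S y := F (Ws y).
have SK y : K (S y) by exact: range_sub_K.
have S_lin c x y : S (c *: x + y) = c *: S x + S y.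
  by rewrite /S (adjoint_linear W_adj) linearP.
have S_f i : S (W (e i)) = f i by rewrite /S adj_W_W proj_F F_basis.
have SB x y : S x - S y = S (x - y).
  by rewrite -scaleN1r addrC -S_lin scaleN1r addrC.
(* [||F Ws y|| = ||A Ws y|| = ||Fs y||], and the square of the last is the frame sum of [y]. *)
have S_low y : K y -> C * rnorm y ^+ 2 <= rnorm (S y) ^+ 2.
  move=> Ky; have [+ _] := hf y Ky.
  rewrite -/(norm2s _) (analysis_norm2s F_basis F_adjoint) lee_fin.
  by rewrite adj_F -rnorm_abs.
have S_inj x y : K x -> K y -> S x = S y -> x = y.
  move=> Kx Ky Sxy; apply: subr0_eq; apply: rnorm_eq0.
  have Kxy : K (x - y) by rewrite addrC -scaleN1r; exact: KP.
  have := S_low _ Kxy; rewrite -SB Sxy subrr /rnorm normr0 expr0n/= -/(rnorm _).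
  have := rnorm_nonneg (x - y); rewrite le_eqVlt => /predU1P[<-//|pos].
  by rewrite leNgt mulr_gt0// exprn_gt0.
(* [y] is in the range of [W], which is that of [F]; if [y = F x], then [W x] is a preimage. *)
have S_surj y : K y -> exists2 z, K z & S z = y.
  move=> Ky; have : range W y by exists (Ws y) => //; exact: W_reconstruction.
  have [_ _ [_ _ ->]] := F_polar => -[x _ xy].
  by exists (W x); [exact: range_W_K|rewrite /S adj_W_W proj_F].
(* [T] is picked pointwise, without condition off [K]; its linearity comes from [S_inj] and its
   bound from [S_low]. *)
have [T TP] : exists T : H -> H, forall y, K y -> K (T y) /\ S (T y) = y.
  have /choice[T hT] : forall y, exists z, K y -> K z /\ S z = y.
    move=> y; have [Ky|nKy] := pselect (K y); last by exists 0.
    by have [z Kz zy] := S_surj y Ky; exists z.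
  by exists T.
exists T, S; split.
- split; first by move=> x /TP[].
    move=> c x y Kx Ky; have [KTx Tx] := TP x Kx; have [KTy Ty] := TP y Ky.
    have [KTxy Txy] := TP _ (KP c x y Kx Ky).
    apply: S_inj => //; first exact: KP.
    by rewrite S_lin Tx Ty.
  exists (Num.sqrt C^-1) => x Kx; have [KTx Tx] := TP x Kx.
  have := S_low _ KTx; rewrite Tx => h.
  rewrite -ler_sqr ?nnegrE ?mulr_ge0 ?sqrtr_ge0 ?rnorm_nonneg//.
  rewrite exprMn sqr_sqrtr; first by rewrite ler_pdivlMl.
  by rewrite invr_ge0 ltW.
- split=> //; exists (MF * MW) => z _; apply: le_trans (hF _) _.
  by rewrite -mulrA ler_wpM2l.
- by move=> x /TP[].
- by move=> y Ky; apply: S_inj => //; have [] := TP _ (SK y).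
- move=> i; apply: S_inj; [by have [] := TP _ (fK i)|exact: range_W_K|].
  by rewrite S_f; have [] := TP _ (fK i).
Qed.

End Adjoint.

(** [V Vs] is the identity on [L], so [V (Vs (V x)) = V x]. As [V = T F] with [T] injective on [K],
    this gives [F (Vs (V x)) = F x], and [proj_unique] applies. *)
Lemma weakly_similar_coisometry L mu :
  normalized_tight_frame L mu -> weakly_similar K f L mu ->
  exists V Vs, [/\ bounded_linear V, forall j, V (e j) = mu j, adjoint V Vs &
    forall x, Vs (V x) = P x].
Proof.
move=> mu_tight [T [S [[TL T_lin [M TM]] _ ST _ Tf]]].
have [MF MF0 hF] := bF.2.
pose V x := T (F x).
have bV : bounded_linear V.
  split=> [c x y|]; first by rewrite /V linearP T_lin//; exact: range_sub_K.
  exists (`|M| * MF) => [|x]; first exact: mulr_ge0.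
  apply: le_trans (TM _ (range_sub_K _)) _.
  apply: le_trans (ler_wpM2r (rnorm_nonneg _) (ler_norm M)) _.
  by rewrite -mulrA ler_wpM2l.
have V_basis j : V (e j) = mu j by rewrite /V F_basis Tf.
have [Vs adjV] := l2_adjoint bV; exists V, Vs; split=> // x.
have V_ker n : F n = 0 -> V n = 0
  by move=> Fn; have := blin0 bV; rewrite /V raddf0 Fn.
apply/esym/proj_unique => [n /V_ker Vn|].
  by rewrite (adjoint_sym adjV) Vn dotp0r.
have VF u v : V u = V v -> F u = F v.
  by rewrite /V => /(congr1 S); rewrite !ST//; exact: range_sub_K.
apply: VF; apply: (tight_reconstruction mu_tight bV V_basis adjV).
exact: (tight_synthesis_range mu_tight bV V_basis).
Qed.

(** * The difference [P - |F|] *)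

Let Q x := P x - A x.

Lemma Q_adjoint : adjoint Q Q.
Proof. by move=> x y; rewrite /Q dotpBl dotpBr proj_adjoint A_adj. Qed.

Let QD x y : Q (x + y) = Q x + Q y.
Proof. by rewrite /Q (raddfD P) (raddfD A) opprD addrACA. Qed.

Lemma Q_basis_invariant b b' : parseval b -> parseval b' ->
  norm2s (fun j => Q (b j)) = norm2s (fun j => Q (b' j)).
Proof. by move=> pb pb'; exact: norm2s_adjoint pb pb' Q_adjoint. Qed.

Lemma Q_perp x : orthocomplement N (Q x).
Proof.
move=> n Fn; rewrite /Q dotpBl proj_perp// A_adj abs_ker// dotp0r subrr//.
Qed.

Lemma W_Q x : W (Q x) = W x - F x.
Proof. by rewrite /Q linearB/= proj_W FE. Qed.

Lemma rnorm_W_Q x : rnorm (W (Q x)) = rnorm (Q x).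
Proof. by rewrite W_isometry proj_id//; exact: Q_perp. Qed.

(** [W - F = W Q], and [W] is isometric on the range of [Q]. *)
Lemma norm2s_W_F : norm2s (fun j => W (e j) - f j) = norm2s (fun j => Q (e j)).
Proof. by apply: eq_norm2s => j; rewrite -F_basis -W_Q rnorm_W_Q. Qed.

Let pe : parseval e. Proof. exact: parseval_onb (l2_basis_orthonormal R). Qed.

(** * Comparison of [W] with a competitor [V] *)

Section Approximation.
Variables (V : l2 R -> H) (Vs : H -> l2 R) (Ws : H -> l2 R).
Hypotheses (bV : bounded_linear V) (V_adj : adjoint V Vs).
Hypotheses (VsV : forall x, Vs (V x) = P x) (W_adj : adjoint W Ws).

Let WsW x : Ws (W x) = P x. Proof. exact: adj_W_W. Qed.

(* [|F|^2 - P = (F - V)^* F + V^* (F - V)], and [|F| + P >= 1] on the range of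
   [|F| - P]. *)
Lemma hs_approx_hs :
  (norm2s (fun j => (V (e j) - F (e j))%R) < +oo)%E ->
  (norm2s (fun j => Q (e j)) < +oo)%E.
Proof.
move=> h; pose D x := V x - F x; pose Ds y := Vs y - Fs y.
have D_adj : adjoint D Ds by move=> x y; rewrite dotpBl dotpBr V_adj F_adjoint.
have [MF MF0 hF] := bF.2; have [MV MV0 hV] := bV.2.
have h1 : (norm2s (fun j => Vs (D (e j))) < +oo)%E.
  by apply: (le_norm2sZ MV0 _ h) => j; exact: (adjoint_bounded V_adj).
have h2 : (norm2s (fun j => Ds (F (e j))) < +oo)%E.
  rewrite (@norm2s_adjoint _ _ _ (fun x => Ds (F x)) (fun x => Fs (D x)) _ e)//.
    by apply: (le_norm2sZ MF0 _ h) => j; exact: (adjoint_bounded F_adjoint).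
  by move=> x y; rewrite (adjoint_sym D_adj) F_adjoint.
have {h1 h2} : (norm2s (fun j => (P (e j) - A (A (e j)))%R) < +oo)%E.
  apply: (norm2s_lincomb_fin (a := 1) (b := 1) _ h1 h2) => j.
  rewrite !scale1r /Ds A_sq -VsV /D; have := adjoint_linear V_adj (-1) (F (e j)) (V (e j)).
  by rewrite !scaleN1r [- F _ + _]addrC [- Vs _ + _]addrC => ->; rewrite addrA subrK.
apply: le_lt_trans; apply: le_norm2s => j; set x := e j.
have -> : P x - A (A x) = A (Q x) + Q x.
  have -> : A (Q x) = A x - A (A x) by rewrite linearB/= proj_A.
  by rewrite [RHS]addrC addrA subrK.
move: (Q x) => y; rewrite -ler_sqr ?nnegrE ?rnorm_nonneg// !rnorm_rdot !rdotE.
have := rdot_ge0 (A y); have := positive_rdot_ge0 A_pos y.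
rewrite [rdot y (A _)]rdotC; lra.
Qed.

Lemma hs_approx_excess (h : nat -> H) :
  parseval h ->
  (norm2s (fun j => (V (e j) - F (e j))%R) < +oo)%E ->
  exists2 l : R,
    (norm2s (fun j => (V (e j) - F (e j))%R) = norm2s (fun j => Q (e j)) + l%:E)%E &
    series (fun k => rdot (A (Vs (h k) - Ws (h k))) (Vs (h k) - Ws (h k))) @ \oo --> l.
Proof.
move=> ph hVF; have hQ := hs_approx_hs hVF.
pose X x := V x - W x; pose Xs y := Vs y - Ws y.
have X_adj : adjoint X Xs by move=> x y; rewrite dotpBl dotpBr V_adj W_adj.
have [MV MV0 hV] := bV.2; have [MW MW0 hW] := bW.2.
have hX : (norm2s (fun j => X (e j)) < +oo)%E.
  apply: (norm2s_lincomb_fin (a := 1) (b := -1) _ hVF _).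
    move=> j; rewrite rmorphN scaleN1r scale1r.
    have -> : X (e j) = V (e j) - F (e j) - W (Q (e j)); last by [].
    by rewrite W_Q opprB addrA subrK.
  rewrite (eq_norm2s (v := fun j => Q (e j)))// => j; exact: rnorm_W_Q.
have [s _ sE] := norm2s_fin hVF; have [t _ tE] := norm2s_fin hQ.
(* [Vs - Fs = Xs + Q Ws], since [Fs = A Ws] and [P] fixes the range of [Ws]. *)
have s_cvg : series (fun k => rnorm (Xs (h k) + Q (Ws (h k))) ^+ 2) @ \oo --> s.
  apply/norm2sP; rewrite -sE.
  rewrite (norm2s_adjoint (X := fun x => V x - F x) (Xs := fun y => Vs y - Fs y) pe ph).
    by apply: eq_norm2s => k; rewrite /Q (adj_F W_adj) proj_id ?addrA ?subrK//;
    exact: (adj_perp _ W_adj).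
  by move=> x y; rewrite dotpBl dotpBr V_adj F_adjoint.
have t_cvg : series (fun k => rnorm (Q (Ws (h k))) ^+ 2) @ \oo --> t.
  apply/norm2sP; rewrite -tE.
  rewrite -(norm2s_adjoint (X := fun x => W (Q x)) (Xs := fun y => Q (Ws y)) pe ph).
    by apply: eq_norm2s => j; exact: rnorm_W_Q.
  by move=> x y; rewrite W_adj Q_adjoint.
(* The vanishing trace. It is moved from [h] to [e], where it pairs [X] with [Y = (V + W) Q], and
   then rewritten as the pairing of [S = (Vs + Ws) X] with [Q]. *)
have z_cvg : series (fun k => rdot (Xs (h k)) (Q (Vs (h k) + Ws (h k)))) @ \oo --> (0 : R).
  pose Y x := V (Q x) + W (Q x).
  have Y_adj : adjoint Y (fun y => Q (Vs y + Ws y)).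
    by move=> x y; rewrite dotpDl V_adj W_adj -dotpDr Q_adjoint.
  have hY : (norm2s (fun j => Y (e j)) < +oo)%E.
    apply: (le_norm2sZ (addr_ge0 MV0 MW0) _ hQ) => j.
    by apply: le_trans (rnorm_triangle _ _) _; rewrite mulrDl lerD.
  have [l l1 l2] := hs_rdot_adjoint pe ph X_adj Y_adj hX hY.
  suff <- : l = 0 by exact: l2.
  pose S x := Vs (X x) + Ws (X x).
  pose Ss y := Xs (V y + W y).
  have S_adj : adjoint S Ss.
    move=> x y; rewrite dotpDl (adjoint_sym V_adj) (adjoint_sym W_adj) -dotpDr.
    exact: X_adj.
  have bVs := adjoint_bounded_linear V_adj bV.
  have bWs := adjoint_bounded_linear W_adj bW.
  (* [Vs V] and [Ws W] both equal [P] and cancel, leaving [S = Ws V - Vs W]. *)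
  have SsE y : Ss y = - S y.
    apply: eq_rdot => z; rewrite /Ss /S /Xs /X.
    rewrite (blinD bVs) (blinD bWs) (blinB bVs) (blinB bWs) VsV WsW !rdotE.
    lra.
  have hS : (norm2s (fun j => S (e j)) < +oo)%E.
    apply: (le_norm2sZ (addr_ge0 MV0 MW0) _ hX) => j.
    apply: le_trans (rnorm_triangle _ _) _; rewrite mulrDl lerD//.
      exact: (adjoint_bounded V_adj).
    exact: (adjoint_bounded W_adj).
  have [m m1 m2] := hs_rdot_adjoint pe pe S_adj Q_adjoint hS hQ.
  have lm : l = m.
    have E : (fun j => rdot (X (e j)) (Y (e j))) = (fun j => rdot (S (e j)) (Q (e j))).
      apply/funext => j; rewrite (rdotDr (X (e j)) (V _)) (rdotDl (Vs (X (e j)))).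
      by rewrite (adjoint_rdot (adjoint_sym V_adj)) (adjoint_rdot (adjoint_sym W_adj)).
    by rewrite -(cvg_lim _ l1)// E; exact: cvg_lim.
  (* Passing to adjoints preserves the sum [m] and replaces [S] by [- S], while [Q] stays the
     same. *)
  have : - m = m.
    have E : (fun j => rdot (Ss (e j)) (Q (e j))) = (- (fun j => rdot (S (e j)) (Q (e j)))).
      by apply/funext => j; rewrite SsE rdotNl.
    rewrite -[RHS](cvg_lim _ m2)// E seriesN; apply/esym/cvg_lim => //.
    exact: cvgN.
  by rewrite lm; lra.
exists (s - t); first by rewrite sE tE -EFinD addrC subrK.
(* With [x = Xs (h k)] and [w = Q (Ws (h k))], one has [Q (Vs (h k) + Ws (h k)) = x - A x + 2 w], so
   each term on the right collapses to [<A x, x>]. *)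
have -> : series (fun k => rdot (A (Xs (h k))) (Xs (h k))) = (fun n =>
   series (fun k => rnorm (Xs (h k) + Q (Ws (h k))) ^+ 2) n
   - series (fun k => rnorm (Q (Ws (h k))) ^+ 2) n
   - series (fun k => rdot (Xs (h k)) (Q (Vs (h k) + Ws (h k)))) n).
  apply/funext => n; rewrite /series/= -!sumrB; apply: eq_bigr => k _.
  have xE : Q (Xs (h k)) = Xs (h k) - A (Xs (h k)).
    congr (_ - _); rewrite /Xs linearB/=.
    by rewrite !proj_id//; [exact: adj_perp W_adj WsW|exact: adj_perp V_adj VsV].
  have -> : Vs (h k) + Ws (h k) = Xs (h k) + Ws (h k) + Ws (h k) by rewrite subrK.
  rewrite !rnorm_rdot; move: (Xs (h k)) xE (Ws (h k)) => x xE w.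
  rewrite !QD xE; move: (Q w) => {}w.
  rewrite !rdotE [rdot w x]rdotC [rdot x (A x)]rdotC; lra.
rewrite -[s - t]subr0; apply: cvgB => //; exact: cvgB.
Qed.

Lemma hs_approx_optimal (h : nat -> H) :
  parseval h ->
  (norm2s (fun j => (V (e j) - F (e j))%R) < +oo)%E ->
  (norm2s (fun j => Q (e j)) <= norm2s (fun j => (V (e j) - F (e j))%R))%E /\
  (norm2s (fun j => (V (e j) - F (e j))%R) = norm2s (fun j => Q (e j)) ->
   forall x, V x = W x).
Proof.
move=> ph hVF; have [l lE l_cvg] := hs_approx_excess ph hVF.
have [t _ tE] := norm2s_fin (hs_approx_hs hVF).
pose Xs y := Vs y - Ws y.
pose a k := rdot (A (Xs (h k))) (Xs (h k)).
have {}l_cvg : series a @ \oo --> l by exact: l_cvg.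
have a_ge0 k : 0 <= a k by exact: positive_rdot_ge0.
have a_le n : series a n <= l.
  rewrite -(cvg_lim _ l_cvg)//; apply: nondecreasing_cvgn_le; last exact: cvgP l_cvg.
  by apply: nondecreasing_series => k _ _; exact: a_ge0.
split.
  rewrite lE leeDl// lee_fin; apply: le_trans (a_le 0%N).
  by rewrite /series/= big_nil.
rewrite lE tE -EFinD => -[] tl x; apply: subr0_eq.
have l0 : l = 0 by move: tl; lra.
have a0 k : a k = 0.
  apply/eqP; rewrite eq_le a_ge0 andbT -l0; apply: le_trans (a_le k.+1).
  by rewrite /series/= big_nat_recr//= lerDr sumr_ge0.
(* [Xs (h k)] is orthogonal to the kernel of [F], and [a k = 0] makes [A], hence [F = W A], vanish
   at it. *)
have Xs0 k : Xs (h k) = 0.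
  apply: perp_ker_eq0.
    move=> n Fn; rewrite dotpBl (adj_perp _ V_adj VsV Fn).
    by rewrite (adj_perp _ W_adj WsW Fn) subrr.
  by rewrite FE (positive_rdot_eq0 A_pos (a0 k)) linear0.
apply: rnorm_eq0; apply/eqP; rewrite -sqrf_eq0; apply/eqP.
apply: EFin_inj; rewrite -(ph _) /norm2s eseries0// => k _ _.
by rewrite dotpBl V_adj W_adj -dotpBr -/(Xs _) Xs0 dotp0r /rnorm normr0 expr0n.
Qed.

End Approximation.

End Polar.

(** * Assembly of the estimate, the equality case and uniqueness *)

Lemma sqrte_lty (R : realType) (x : \bar R) :
  (0 <= x)%E -> (sqrte x < +oo)%E = (x < +oo)%E.
Proof.
move=> x0; rewrite -(ge0_fin_numE (sqrte_ge0 x)) -(ge0_fin_numE x0).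
exact: sqrte_fin_num.
Qed.

Local Open Scope ereal_scope.

Theorem theorem2p3 (R : realType) (H : hilbertType R)
    (K : set H) (f : nat -> H)
    (F W : {linear l2 R -> H}) (Fs : {linear H -> l2 R})
    (absF P : {linear l2 R -> l2 R}) (b : nat -> l2 R)
    (H_separable : separable_space H)
    (f_frame : frame K f)
    (F_continuous : continuous F)
    (F_basis : forall i, F (l2_basis R i) = f i)
    (F_adjoint : adjoint F Fs)
    (F_abs : operator_abs F Fs absF)
    (F_polar : polar_decomposition F W absF)
    (P_proj : orthogonal_projection (closure (range (fun x => Fs (F x)))) P)
    (b_basis : orthonormal_basis b) :
  let We := fun i => W (l2_basis R i) in
  let Q := fun x => (P x - absF x)%R in
  (hilbert_schmidt b Q <->
     exists L mu, [/\ normalized_tight_frame L mu, weakly_similar K f L mu &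
                      sq_dist mu f < +oo])
  /\
  (hilbert_schmidt b Q ->
     [/\ forall L mu, normalized_tight_frame L mu -> weakly_similar K f L mu ->
           sq_dist We f <= sq_dist mu f
           /\ (sq_dist mu f = sq_dist We f <-> forall i, mu i = We i),
         sq_dist We f = hs_norm b Q ^+ 2,
         symmetric_approximation K f K We &
         forall L nu, symmetric_approximation K f L nu ->
           [/\ L = K, normalized_tight_frame K nu & similar_frames K f nu]]).
Proof.
move=> We Q.
have [h ph] := separable_parseval H_separable.
have bW : bounded_linear W by apply: continuous_bounded_linear; have [] := F_polar.
have [Ws W_adj] := l2_adjoint bW.
have pe := parseval_onb (l2_basis_orthonormal R).
have We_tight : normalized_tight_frame K We.
  exact: (W_tight f_frame F_continuous F_basis F_adjoint F_abs F_polar P_proj W_adj).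
have We_sim : weakly_similar K f K We.
  exact: (W_similar f_frame F_continuous F_basis F_adjoint F_abs F_polar P_proj W_adj).
have WeQ : sq_dist We f = norm2s (fun j => Q (l2_basis R j)).
  exact: (norm2s_W_F F_basis F_adjoint F_abs F_polar P_proj).
have Qb : norm2s (fun j => Q (b j)) = norm2s (fun j => Q (l2_basis R j)).
  exact: (Q_basis_invariant F_adjoint F_abs P_proj (parseval_onb b_basis) pe).
have hsE : hilbert_schmidt b Q <-> sq_dist We f < +oo.
  by rewrite /hilbert_schmidt /hs_norm sqrte_lty ?norm2s_ge0// -/(norm2s _) Qb WeQ.
have coiso L mu : normalized_tight_frame L mu -> weakly_similar K f L mu ->
    sq_dist mu f < +oo ->
    sq_dist We f <= sq_dist mu f /\
    (sq_dist mu f = sq_dist We f -> forall i, mu i = We i).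
  move=> mu_tight mu_sim mu_fin.
  have [V [Vs [bV V_basis V_adj VsV]]] := weakly_similar_coisometry
    f_frame F_continuous F_basis F_adjoint P_proj mu_tight mu_sim.
  have muE : sq_dist mu f =
      norm2s (fun j => (V (l2_basis R j) - F (l2_basis R j))%R).
    by apply: eq_norm2s => j; rewrite V_basis F_basis.
  rewrite muE in mu_fin.
  have [Qle Qeq] := hs_approx_optimal F_continuous F_adjoint F_abs F_polar P_proj
    bV V_adj VsV W_adj ph mu_fin.
  rewrite muE WeQ; split=> // E i.
  by rewrite -V_basis Qeq.
split.
  rewrite hsE; split=> [We_fin|[L [mu [mu_tight mu_sim mu_fin]]]].
    by exists K, We.
  apply: le_lt_trans (mu_fin); exact: (coiso L mu mu_tight mu_sim mu_fin).1.
rewrite hsE => We_fin.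
have opt L mu : normalized_tight_frame L mu -> weakly_similar K f L mu ->
    sq_dist We f <= sq_dist mu f /\
    (sq_dist mu f = sq_dist We f <-> forall i, mu i = We i).
  move=> mu_tight mu_sim.
  have dist_eq : (forall i, mu i = We i) -> sq_dist mu f = sq_dist We f.
    by move=> E; apply: eq_norm2s => j; rewrite E.
  (* At infinite distance the inequality is trivial, and equality is excluded because [We] is at
     finite distance. *)
  have [mu_fin|] := ltP (sq_dist mu f) +oo.
    by have [] := coiso L mu mu_tight mu_sim mu_fin.
  rewrite leye_eq => /eqP mu_oo; split; first by rewrite mu_oo leey.
  by split=> // E; move: We_fin; rewrite -E mu_oo ltxx.
have We_approx : symmetric_approximation K f K We.
  by split=> // M mu mu_tight mu_sim; exact: (opt M mu mu_tight mu_sim).1.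
split=> //.
  rewrite /hs_norm sqr_sqrte ?norm2s_ge0// -/(norm2s _) Qb; exact: WeQ.
move=> L nu [nu_tight nu_sim nu_min nu_fin].
have [le_We eq_We] := opt L nu nu_tight nu_sim.
(* [We] is itself a competitor, so minimality of [nu] gives equal distances, and the equality case
   applies. *)
have nuE : nu = We.
  apply/funext/(proj1 eq_We)/eqP; rewrite eq_le le_We andbT; exact: (nu_min K We).
rewrite nuE in nu_tight *; split=> //.
have bas : forall j, W (l2_basis R j) = We j by [].
(* [We] is tight in both [L] and [K]: [W Ws] is the identity on each, and [W] maps into both. *)
apply/seteqP; split=> y Hy.
  rewrite -(tight_reconstruction nu_tight bW bas W_adj Hy).
  exact: (tight_synthesis_range We_tight bW bas).
rewrite -(tight_reconstruction We_tight bW bas W_adj Hy).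
exact: (tight_synthesis_range nu_tight bW bas).
Qed.
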